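(* Let $\mathcal T$ be a rational tree such that $\mathrm{Nd}(\mathcal T)=\mathrm{Nd}^*(\mathcal T)$. Then the following hold. (a) If $\Omega(\mathcal T)=\emptyset$ then $\mathcal T$ is one of the elementary trees (E1), (E2). (b) If $|\Omega(\mathcal T)|=1$ then there is a path $(z_1,\dots,z_n)$ in $\mathcal N$ with $n>1$, $\Omega(\mathcal T)=\{z_1\}=\{v_0\}$, $\delta_{v_0}=1$ and $S(\mathcal T)=\{z_1,\dots,z_n\}$, such that the tree $\mathcal N$ is one of the following: (i) $\mathcal N=\{z_1,\dots,z_n\}$; (ii) $\mathcal N=\{z_1,\dots,z_n,y_1\}$, with $y_1\notin\{z_1,\dots,z_n\}$ adjacent in $\mathcal N$ to $z_n$ only; (iii) $\mathcal N=\{z_1,\dots,z_n,y_1,y_2\}$, with $y_1\ne y_2$ not in $\{z_1,\dots,z_n\}$, each adjacent in $\mathcal N$ to $z_n$ only. Moreover: - in case (i), $\mathrm{Nd}(\mathcal T)=\{z_n\}$ and the type of $z_n$ is either $[1]$ or $[1,1]$; - in case (ii), $V(z_n)=\{y_1\}$ and either $\mathrm{Nd}(\mathcal T)=\{y_1\}$ or $\mathrm{Nd}(\mathcal T)=\{z_n,y_1\}$; the type of $y_1$ is $[1,N_{y_1},\dots,N_{y_1}]$, and if $z_n\in\mathrm{Nd}(\mathcal T)$ then its type is $[1]$; - in case (iii), $V(z_n)=\mathrm{Nd}(\mathcal T)=\{y_1,y_2\}$ and, for each $i=1,2$, the type of $y_i$ is $[1,N_{y_i},\dots,N_{y_i}]$.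 (c) If $|\Omega(\mathcal T)|=2$ then all of the following hold: there is a $\widetilde\Delta$-trivial path $(z_1,\dots,z_n)$ such that $\mathcal N=\{z_1,\dots,z_n\}$; $n\in\{2,3\}$, and if $n=3$ then $v_0=z_2$; $a_{z_i}=1$ for all $i=1,\dots,n$; $\mathrm{Nd}(\mathcal T)=\{z_1,z_n\}$ and each node $v$ has type $[d_1,\dots,d_s]=[1,N_v,\dots,N_v]$, where $s=1\Leftrightarrow v=v_0$.
   Context: **Decorated rooted trees.** A rooted tree is a finite tree with set of cells $X_0$, edges (2-element subsets of $X_0$) and a root $v_0\in X_0$; $\delta_x$ is the valency of $x$, and $\gamma_{x,y}$ the unique path from $x$ to $y$. Arrows: $\mathcal A=\{x:\delta_x=1\}\setminus\{v_0\}$; vertices: $\mathcal V=X_0\setminus\mathcal A$. For distinct $x,y$, $x<y$ means that $x$ is on $\gamma_{v_0,y}$. In a decorated rooted tree, each arrow is decorated by $(0)$ or $(1)$ ($\mathcal A_0$ = set of arrows decorated by $(0)$), and each pair $(e,x)$ with $e$ an edge and $x\in e$ carries an integer $q(e,x)$ (decoration of $e$ near $x$). $Q(e,x)=\prod q(e',x)$ over edges $e'\ne e$ incident to $x$ (empty products are $1$). For an edge $e=\{x,y\}$ with $x,y\in\mathcal V$, $\det(e)=q(e,x)q(e,y)-Q(e,x)Q(e,y)$. A dead end is an edge incident to an element of $\mathcal A_0$. **Abstract Newton tree at infinity**: a decorated rooted tree such that (1) for each $v\in\mathcal V$ some $\alpha\in\mathcal A\setminus\mathcal A_0$ satisfies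 $\alpha>v$; (2) at most one dead end is incident to a given vertex; (3) $q(e,v_0)=1$ for all edges $e$ incident to $v_0$; (4) $q(e,\alpha)=1$ for every edge $e$ incident to an arrow $\alpha$; (5) for $v\in\mathcal V$ and distinct edges $e,e'$ incident to $v$, $q(e,v)$ and $q(e',v)$ are coprime; with $E_v^+$ the set of edges $\{v,x\}$ with $v<x$, $q(e,v)\ge1$ for all $e\in E_v^+$, at most one $e\in E_v^+$ has $q(e,v)>1$, and if a dead end $\epsilon$ is incident to $v$ then $q(\epsilon,v)=\max_{e\in E_v^+}q(e,v)$; (6) $\det(e)<0$ for every edge $e$ joining two vertices. For $v\in\mathcal V$, $\alpha\in\mathcal A\setminus\mathcal A_0$: $x_{v,\alpha}$ is the product of $q(\epsilon,u)$ over all edges $\epsilon$ not in $\gamma_{v,\alpha}$ but incident to a cell $u$ of $\gamma_{v,\alpha}$; $N_v=\sum_{\alpha\in\mathcal A\setminus\mathcal A_0}x_{v,\alpha}$. A dicritical vertex is a vertex with $N_v=0$; $\mathcal D$ is the set of dicritical vertices. The tree is **minimally complete** if (i) $N_v\ge0$ for all $v\in\mathcal V$ and each arrow decorated by $(1)$ is adjacent to a dicritical vertex; (ii) a dead end is incident to each dicritical vertex; (iii) if a dead end $e$ incident to a vertex $v$ has $q(e,v)=1$ then $v$ is dicritical; (iv) every vertex $\ne v_0$ has valency $\ne2$. **Notation.** $\mathcal N=\{v\in\mathcal V:N_v>0\}$ (a subtree containing $v_0$). $\mathcal D_v$: set of dicritical vertices adjacent to $v$. Degree $d_u$ of a dicritical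 $u$: number of $(1)$-arrows adjacent to $u$. $v\in\mathcal N$ is a node if $\mathcal D_v\neq\emptyset$; $\mathrm{Nd}(\mathcal T)$ is the set of nodes; the type of a node $v$ is the nondecreasing sequence $[d_1,\dots,d_s]$ of degrees of the elements of $\mathcal D_v$; $\mathrm{Nd}^*(\mathcal T)$ is the set of nodes whose type satisfies $\gcd(d_1,\dots,d_s)=1$. $a_v=q(e,v)$ if a dead end $e$ is incident to $v$, $a_v=1$ otherwise. $r_v=-1+$ (number of vertices adjacent to $v$). $\epsilon(v)$: number of elements of $\mathcal N$ adjacent to $v$. For $v\in\mathcal N$: $\widetilde\Delta(v)=(r_v-1)(N_v-1)+N_v(1-\frac1{a_v})-\sum_{u\in\mathcal D_v}(d_u-1)$, and $\widetilde\Delta(S)=\sum_{v\in S}\widetilde\Delta(v)$ for $S\subseteq\mathcal N$. **Rational tree**: a minimally complete abstract Newton tree at infinity with $\widetilde\Delta(\mathcal N)=0$ and $\gcd\{d_x:x\in\mathcal D\}=1$. **Teeth, skeleton.** A $\widetilde\Delta$-trivial path is a path $(z_1,\dots,z_n)$ in $\mathcal N$ with $n>1$, $\epsilon(z_1)=1$, and $\epsilon(z_i)=2$, $\widetilde\Delta(z_i)=0$ for $1<i<n$. $Z=\{z\in\mathcal N:\epsilon(z)=1,\widetilde\Delta(z)\le0\}$. $\Gamma$: set of $\widetilde\Delta$-trivial paths with $\widetilde\Delta(z_1)\le0<\widetilde\Delta(\{z_1,\dots,z_n\})$ and $z_{n-1}>z_n$. $W$: set of last vertices $z_n$ of elements of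 $\Gamma$. For $w\in W$, $V(w)=\{v:\gamma_{v,w}\in\Gamma\}$ and $\bar V(w)$ is the set of all vertices on the paths $\gamma_{v,w}$, $v\in V(w)$; for $w\in\mathcal N\setminus W$, $V(w)=\emptyset$ and $\bar V(w)=\{w\}$. $\Omega(\mathcal T)=Z\setminus\bigcup_{w\in W}V(w)$. $S(\mathcal T)=\mathcal N\setminus\bigcup_{w\in W}(\bar V(w)\setminus\{w\})$. **Elementary trees.** (E1): vertices $v_0,u$; edge $e=\{v_0,u\}$; one $(1)$-arrow and one $(0)$-arrow attached to $u$; $q(e,u)=0$ and all other edge decorations are $1$. (E2): for some positive integers $a_1,a_2$ with $\gcd(a_1,a_2)=1$: vertices $v_0,u_1,u_2$; edges $\{v_0,u_1\},\{v_0,u_2\}$; to each $u_i$ are attached one $(1)$-arrow and one $(0)$-arrow; the dead end at $u_i$ is decorated $a_i$ near $u_i$; $q(\{v_0,u_1\},u_1)=-a_2$, $q(\{v_0,u_2\},u_2)=-a_1$; all other edge decorations are $1$. *)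

(* Defs.v *)
From mathcomp Require Import all_boot all_order all_algebra.

Set Implicit Arguments.
Unset Strict Implicit.
Unset Printing Implicit Defensive.

Import Order.TTheory GRing.Theory Num.Theory.

Local Open Scope ring_scope.

(* ---------- Paths in a finite graph given by its set of edges ---------- *)

Definition edge_rel (X : finType) (E : {set {set X}}) : rel X :=
  fun x y => [set x; y] \in E.

(* Paths do not repeat cells; (x) is a path. *)
Definition is_path (X : finType) (E : {set {set X}}) (z : seq X) : bool :=
  if z is x :: p then path (edge_rel E) x p && uniq z else false.

Definition path_between (X : finType) (E : {set {set X}}) (x y : X)
    (z : seq X) : bool :=
  [&& is_path E z, head x z == x & last y z == y].

Definition path_edges (X : finType) (z : seq X) : seq {set X} :=
  if z is x :: p then pairmap (fun u w => [set u; w]) x p else [::].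

(* ---------- Decorated rooted trees ---------- *)

(* [one_arrow] is only meaningful on arrows ([true] for the decoration (1),
   [false] for (0)), and [q e x] only when [e] is an edge and [x \in e]. *)
Record decorated_tree := DecoratedTree {
  cell :> finType;
  edges : {set {set cell}};
  v0 : cell;
  one_arrow : pred cell;
  q : {set cell} -> cell -> int;
  edges_card2 : forall e, e \in edges -> #|e| = 2%N;
  unique_path : forall x y : cell, exists! z, path_between edges x y z
}.

Definition adj (T : decorated_tree) : rel T := edge_rel (edges T).

Lemma path_exists (T : decorated_tree) (x y : T) :
  exists z, path_between (edges T) x y z.
Proof. by have [z [zP _]] := unique_path x y; exists z. Qed.

(* The path from [x] to [y], both ends included. *)
Definition gam (T : decorated_tree) (x y : T) : seq T :=
  xchoose (path_exists x y).

Definition valency (T : decorated_tree) (x : T) : nat :=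
  #|[set e in edges T | x \in e]|.

Definition arrows (T : decorated_tree) : {set T} :=
  [set x : T | valency x == 1%N] :\ v0 T.

Definition vertices (T : decorated_tree) : {set T} := ~: arrows T.

Definition arrows0 (T : decorated_tree) : {set T} :=
  [set x in arrows T | ~~ one_arrow x].

Definition arrows1 (T : decorated_tree) : {set T} := arrows T :\: arrows0 T.

Definition tlt (T : decorated_tree) (x y : T) : bool :=
  (x != y) && (x \in gam (v0 T) y).

Definition Q (T : decorated_tree) (e : {set T}) (x : T) : int :=
  \prod_(e' in edges T | (x \in e') && (e' != e)) q e' x.

Definition det (T : decorated_tree) (x y : T) : int :=
  let e := [set x; y] in q e x * q e y - Q e x * Q e y.

Definition dead_end (T : decorated_tree) (e : {set T}) : bool :=
  (e \in edges T) && [exists x in arrows0 T, x \in e].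

Definition Eplus (T : decorated_tree) (v : T) : {set {set T}} :=
  [set e in edges T | [exists x, (e == [set v; x]) && tlt v x]].

(* In [newton_dead_end_max], the decorations involved are at least 1 and
   [eps] itself is in [Eplus v], so the default value 0 of the iterated maximum
   plays no role. *)
Record newton_tree (T : decorated_tree) : Prop := NewtonTree {
  newton_one_above : forall v, v \in vertices T ->
    exists2 alpha, alpha \in arrows1 T & tlt v alpha;
  newton_dead_end_unique : forall v, v \in vertices T ->
    (#|[set e : {set T} | dead_end e && (v \in e)]| <= 1)%N;
  newton_q_root : forall e, e \in edges T -> v0 T \in e -> q e (v0 T) = 1;
  newton_q_arrow : forall alpha e, alpha \in arrows T -> e \in edges T ->
    alpha \in e -> q e alpha = 1;
  newton_coprime : forall v e e', v \in vertices T ->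
    e \in edges T -> e' \in edges T -> v \in e -> v \in e' -> e != e' ->
    coprimez (q e v) (q e' v);
  newton_Eplus_ge1 : forall v e, v \in vertices T -> e \in Eplus v ->
    1 <= q e v;
  newton_Eplus_gt1 : forall v, v \in vertices T ->
    (#|[set e in Eplus v | (1 < q e v)%R]| <= 1)%N;
  newton_dead_end_max : forall v eps, v \in vertices T ->
    dead_end eps -> v \in eps ->
    q eps v = \big[Num.max/0]_(e in Eplus v) q e v;
  newton_det : forall x y, x \in vertices T -> y \in vertices T ->
    adj x y -> det x y < 0
}.

(* ---------- Multiplicities and minimally complete trees ---------- *)

Definition xmult (T : decorated_tree) (v alpha : T) : int :=
  \prod_(e in edges T | e \notin path_edges (gam v alpha))
    \prod_(u in e | u \in gam v alpha) q e u.

Definition mult (T : decorated_tree) (v : T) : int :=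
  \sum_(alpha in arrows1 T) xmult v alpha.

Definition dicriticals (T : decorated_tree) : {set T} :=
  [set v in vertices T | mult v == 0].

Record minimally_complete (T : decorated_tree) : Prop := MinimallyComplete {
  mc_mult_ge0 : forall v, v \in vertices T -> 0 <= mult v;
  mc_arrows1 : forall alpha, alpha \in arrows1 T ->
    exists2 u, u \in dicriticals T & adj alpha u;
  mc_dicritical : forall u, u \in dicriticals T ->
    exists2 e, dead_end e & u \in e;
  mc_dead_end1 : forall v e, v \in vertices T -> dead_end e -> v \in e ->
    q e v = 1 -> v \in dicriticals T;
  mc_valency : forall v, v \in vertices T -> v != v0 T -> valency v <> 2%N
}.

Definition calN (T : decorated_tree) : {set T} :=
  [set v in vertices T | 0 < mult v].

Definition dic_at (T : decorated_tree) (v : T) : {set T} :=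
  [set u in dicriticals T | adj v u].

Definition deg (T : decorated_tree) (u : T) : nat :=
  #|[set alpha in arrows1 T | adj u alpha]|.

Definition nodes (T : decorated_tree) : {set T} :=
  [set v in calN T | dic_at v != set0].

Definition node_type (T : decorated_tree) (v : T) : seq nat :=
  sort leq [seq deg u | u <- enum (dic_at v)].

Definition nodes_star (T : decorated_tree) : {set T} :=
  [set v in nodes T | \big[gcdn/0%N]_(d <- node_type v) d == 1%N].

Definition a_ (T : decorated_tree) (v : T) : int :=
  if [pick e : {set T} | dead_end e && (v \in e)] is Some e then q e v else 1.

Definition r_ (T : decorated_tree) (v : T) : int :=
  - 1 + #|[set x in vertices T | adj v x]|%:Z.

Definition epsilon (T : decorated_tree) (v : T) : nat :=
  #|[set x in calN T | adj v x]|.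

Definition Delta (T : decorated_tree) (v : T) : rat :=
  ((r_ v)%:~R - 1) * ((mult v)%:~R - 1)
  + (mult v)%:~R * (1 - 1 / (a_ v)%:~R)
  - \sum_(u in dic_at v) ((deg u)%:R - 1).

Definition Delta_set (T : decorated_tree) (S : {set T}) : rat :=
  \sum_(v in S) Delta v.

Record rational_tree (T : decorated_tree) : Prop := RationalTree {
  rational_newton : newton_tree T;
  rational_complete : minimally_complete T;
  rational_Delta : Delta_set (calN T) = 0;
  rational_gcd : \big[gcdn/0%N]_(x in dicriticals T) deg x = 1%N
}.

(* ---------- Teeth and skeleton ---------- *)

(* In a path (z_1, ..., z_n), z_(i+1) is [nth _ z i]. *)
Definition path_in_calN (T : decorated_tree) (z : seq T) : bool :=
  is_path (edges T) z && all [in calN T] z.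

Definition trivial_path (T : decorated_tree) (z : seq T) : bool :=
  [&& path_in_calN z, (1 < size z)%N, epsilon (head (v0 T) z) == 1%N
    & [forall i : 'I_(size z), (0 < i < (size z).-1)%N ==>
        (epsilon (nth (v0 T) z i) == 2%N) && (Delta (nth (v0 T) z i) == 0)]].

Definition Zset (T : decorated_tree) : {set T} :=
  [set z in calN T | (epsilon z == 1%N) && (Delta z <= 0)].

Definition in_Gamma (T : decorated_tree) (z : seq T) : bool :=
  [&& trivial_path z, Delta (head (v0 T) z) <= 0,
      0 < Delta_set [set x in z]
    & tlt (last (v0 T) z) (nth (v0 T) z (size z).-2)].

(* A path with first cell v and last cell w is [gam v w]. *)
Definition Wset (T : decorated_tree) : {set T} :=
  [set w : T | [exists v : T, in_Gamma (gam v w)]].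

(* Empty when w is not in [Wset T]. *)
Definition Vset (T : decorated_tree) (w : T) : {set T} :=
  [set v : T | in_Gamma (gam v w)].

Definition Vbar (T : decorated_tree) (w : T) : {set T} :=
  if w \in Wset T then \bigcup_(v in Vset w) [set x in gam v w] else [set w].

Definition Omega (T : decorated_tree) : {set T} :=
  Zset T :\: \bigcup_(w in Wset T) Vset w.

Definition skeleton (T : decorated_tree) : {set T} :=
  calN T :\: \bigcup_(w in Wset T) (Vbar w :\ w).

(* ---------- Elementary trees, up to isomorphism ---------- *)

Definition elementary1 (T : decorated_tree) : Prop :=
  exists u alpha beta : T,
  [/\ uniq [:: v0 T; u; alpha; beta],
      [set: T] = [set v0 T; u; alpha; beta],
      edges T = [set [set v0 T; u]; [set u; alpha]; [set u; beta]],
      one_arrow alpha && ~~ one_arrow beta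
    & q [set v0 T; u] u = 0 /\
      (forall e x, e \in edges T -> x \in e -> (e, x) != ([set v0 T; u], u) ->
         q e x = 1)].

Definition elementary2 (T : decorated_tree) : Prop :=
  exists (a1 a2 : nat) (u1 u2 alpha1 alpha2 beta1 beta2 : T),
  [/\ [&& 0 < a1, 0 < a2 & coprime a1 a2]%N,
      uniq [:: v0 T; u1; u2; alpha1; alpha2; beta1; beta2],
      [set: T] = [set v0 T; u1; u2; alpha1; alpha2; beta1; beta2]
    & edges T = [set [set v0 T; u1]; [set v0 T; u2];
                     [set u1; alpha1]; [set u1; beta1];
                     [set u2; alpha2]; [set u2; beta2]]] /\
  [/\ [&& one_arrow alpha1, one_arrow alpha2,
          ~~ one_arrow beta1 & ~~ one_arrow beta2],
      q [set u1; beta1] u1 = a1%:Z /\ q [set u2; beta2] u2 = a2%:Z,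
      q [set v0 T; u1] u1 = - a2%:Z /\ q [set v0 T; u2] u2 = - a1%:Z
    & forall e x, e \in edges T -> x \in e ->
        (e, x) \notin [:: ([set u1; beta1], u1); ([set u2; beta2], u2);
                          ([set v0 T; u1], u1); ([set v0 T; u2], u2)] ->
        q e x = 1].

(* The type of v is [1, N_v, ..., N_v], with any number (possibly zero) of
   entries N_v. *)
Definition type_one_mult (T : decorated_tree) (v : T) : Prop :=
  exists k : nat, [seq d%:Z | d <- node_type v] = 1 :: nseq k (mult v).

(* Main.v *)
Require Import Defs.
From mathcomp Require Import all_boot all_order all_algebra.
From mathcomp Require Import zify ring lra.

Set Implicit Arguments.
Unset Strict Implicit.
Unset Printing Implicit Defensive.

Import Order.TTheory GRing.Theory Num.Theory.

Local Open Scope ring_scope.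

(** The proof compares multiplicities at the two ends of an edge. Let [w] be a
    child of the vertex [v], and let [Yup w] collect the contribution to the
    multiplicities of the (1)-arrows above [w]. Each of these arrows contributes
    to [mult v] and [mult w] through a common factor, and so does each other
    arrow; elimination gives, in [mult_edge], the decoration of the edge near
    [v] times [mult w] as [Qup w * mult v + det v w * Yup w], where [det v w < 0]
    when [w] is a vertex. It follows that dicriticals are maximal vertices, that
    the degree of a dicritical adjacent to [v] divides [mult v], and that
    [mult v >= 2] as soon as some element of [calN T] lies above [v].

    If [v <> v0 T] in [calN T] has [c] successors in [calN T], then
<<
      Delta v = c (mult v - 1) + 1 - mult v / a_ v + slack v,
>>
    where [slack v] is the sum of the [mult v - d] over the degrees [d] of the
    dicriticals at [v]. At a node these are divisors of [mult v] with greatest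
    common divisor 1, so that [slack v >= mult v - 1], with equality exactly for
    the types [1, N, ..., N] ([gcd1_slack]: two proper divisors already
    miss [N]). Hence [Delta v >= 0] for [v <> v0 T], and [Delta v = 0] only for
    leaves of type [1, N, ..., N] without dead end ([Delta_eq0]). As the values
    of [Delta] add up to 0, everything depends on the root, which has no dead
    end:

    - if [calN T] is reduced to the root, then [slack] at the root is
      [2 (mult - 1)] while the degrees have sum at most [mult]; this leaves one
      or two dicriticals of degree 1, and the decorations are then determined
      ([elementary]);

    - if [Delta] is nonnegative at the root, it vanishes everywhere; all the
      other vertices of [calN T] are leaves, the root has at most two of them
      and [Omega T] consists of the two ends of [calN T]
      ([nonnegative_structure]);

    - otherwise the root is a leaf of [calN T] without dicriticals, and
      [Delta (v0 T) = 1 - mult (v0 T)] must be compensated. Going up, as long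
      as a vertex [v] has a single successor [w] and no dicriticals, it has a
      dead end, [mult v = Yup v], and the sum of [Delta] over the part of
      [calN T] above [v] is [Yup w - 1]: the situation repeats itself ([chain]).
      The first vertex [zn] where this fails carries all that is missing:
      either it is a leaf, or all vertices above it have [Delta] equal to 0,
      hence are leaves adjacent to [zn], at most two in number. The paths of
      [Gamma] are then the edges from these leaves to [zn], which determines
      [Omega T] and the skeleton ([comb_structure]). *)

(** * Paths and the order of a rooted tree *)

Section Tree.

Variable T : decorated_tree.
Implicit Types x y v w : T.

Lemma adjC x y : adj x y = adj y x.
Proof. by rewrite /adj /edge_rel setUC. Qed.

Lemma adj_neq x y : adj x y -> x != y.
Proof. by move/edges_card2; rewrite cards2; case: eqP. Qed.

Lemma set2_inj v : injective (fun x => [set v; x]).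
Proof.
move=> x y e; have := set22 v x; rewrite e !inE => /orP[]/eqP // xv.
by have := set22 v y; rewrite -e xv !inE orbb => /eqP.
Qed.

Lemma edgeP v e :
  reflect (exists2 x, adj v x & e = [set v; x]) ((e \in edges T) && (v \in e)).
Proof.
apply: (iffP andP) => [[eE ve] | [x vx ->]]; last by rewrite set21.
have /eqP/cards2P[a [b [ab eab]]] := edges_card2 eE.
move: ve; rewrite eab !inE => /orP[]/eqP->.
  by exists b; rewrite // /adj /edge_rel -eab.
by exists a; [rewrite /adj /edge_rel setUC -eab | rewrite setUC].
Qed.

Lemma edges_at v :
  [set e in edges T | v \in e] = [set [set v; x] | x in [set x | adj v x]].
Proof.
apply/setP=> e; rewrite inE; apply/edgeP/imsetP => [[x vx ->]|[x]].
  by exists x; rewrite ?inE.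
by rewrite inE => vx ->; exists x.
Qed.

Lemma valencyE v : valency v = #|[set x | adj v x]|.
Proof. by rewrite /valency edges_at card_imset //; apply: set2_inj. Qed.

Lemma prod_edges_at v (P : pred {set T}) (F : {set T} -> int) :
  \prod_(e in edges T | (v \in e) && P e) F e
    = \prod_(x | adj v x && P [set v; x]) F [set v; x].
Proof.
rewrite (eq_bigl (fun e => (e \in [set e in edges T | v \in e]) && P e));
  last by move=> e; rewrite inE andbA.
rewrite big_mkcondr edges_at big_imset /=; last by move=> x y _ _; apply: set2_inj.
by rewrite -big_mkcondr; apply: eq_bigl => x; rewrite inE.
Qed.

Lemma gamP x y : path_between (edges T) x y (gam x y).
Proof. exact: xchooseP. Qed.

Lemma gam_eq x y z : path_between (edges T) x y z -> gam x y = z.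
Proof.
have [z0 [_ u]] := unique_path x y => zP.
by rewrite -(u z zP) -(u _ (gamP x y)).
Qed.

Lemma gam_cons x y : exists p,
  [/\ gam x y = x :: p, path (@adj T) x p, uniq (x :: p) & last x p = y].
Proof.
have := gamP x y; case: (gam x y) => // x' p /and3P[/andP[pP u] /eqP/= <- /eqP l].
by exists p.
Qed.

Lemma gam_path x p : path (@adj T) x p -> uniq (x :: p) ->
  gam x (last x p) = x :: p.
Proof. by move=> xp u; apply: gam_eq; apply/and3P; rewrite /= xp eqxx. Qed.

Lemma gam_uniq x y : uniq (gam x y).
Proof. by have [p [-> _ u _]] := gam_cons x y. Qed.

Lemma mem_gam_l x y : x \in gam x y.
Proof. by have [p [-> _ _ _]] := gam_cons x y; rewrite mem_head. Qed.

Lemma mem_gam_r x y : y \in gam x y.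
Proof. by have [p [-> _ _ <-]] := gam_cons x y; rewrite mem_last. Qed.

Lemma gamxx x : gam x x = [:: x].
Proof. exact: (@gam_path x [::]). Qed.

(** A walk can only be shortened, so the path uses no cell outside of it. *)
Lemma gam_sub_walk x p : path (@adj T) x p ->
  {subset gam x (last x p) <= x :: p}.
Proof.
move=> xp; case/shortenP: xp => p' xp' u s.
rewrite gam_path // => y; rewrite !inE => /orP[->//|/s ->].
by rewrite orbT.
Qed.

Lemma gam_split x y z : y \in gam x z -> exists p1 p2,
  [/\ gam x y = x :: p1, gam y z = y :: p2 & gam x z = x :: p1 ++ p2].
Proof.
have [p [e xp u l]] := gam_cons x z; rewrite e => yin.
case/splitPl: yin e xp u l => p1 p2 ly e; rewrite cat_path ly => /andP[xp1 yp2].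
rewrite -cat_cons cat_uniq => /and3P[u1 h u2]; rewrite last_cat ly => lz.
exists p1, p2; split=> //; first by rewrite -ly gam_path.
rewrite -lz gam_path //= u2 andbT; apply: contra h => yin.
by apply/hasP; exists y => //; rewrite -ly mem_last.
Qed.

(** ** Children and parents *)

Definition ch v : {set T} := [set x | adj v x & tlt v x].

(** The root is its own parent; [{v0, v0}] is not an edge, so excluding it from
    a product of edge decorations has no effect. *)
Definition par v : T := last (v0 T) (belast (v0 T) (behead (gam (v0 T) v))).

Lemma tltNge x y : tlt x y -> y \notin gam (v0 T) x.
Proof.
case/andP=> xy /gam_split[p1 [p2 [e1 e2 e]]]; rewrite e1; apply/negP=> yin.
have := gam_uniq (v0 T) y; rewrite e -cat_cons cat_uniq => /and3P[_ /hasP[]].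
exists y => //; have := mem_gam_r x y; rewrite e2 inE eq_sym (negPf xy) //.
Qed.

Lemma adj_gam x y : adj x y -> y \notin gam (v0 T) x ->
  gam (v0 T) y = rcons (gam (v0 T) x) y.
Proof.
move=> xy; have [p [e vp u l]] := gam_cons (v0 T) x; rewrite e => yn.
rewrite -[y in LHS](last_rcons (v0 T) p) gam_path //.
  by rewrite rcons_path vp /= l.
by rewrite -rcons_cons rcons_uniq yn.
Qed.

Lemma chE v x : (x \in ch v) = adj v x && (x \notin gam (v0 T) v).
Proof.
rewrite inE; case vx: (adj v x) => //=; apply/idP/idP; first exact: tltNge.
move=> xn; rewrite /tlt adj_neq //= (adj_gam vx xn) mem_rcons inE mem_gam_r orbT //.
Qed.

Lemma ch_adj v x : x \in ch v -> adj v x.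
Proof. by rewrite inE => /andP[]. Qed.

Lemma ch_gam v x : x \in ch v -> gam (v0 T) x = rcons (gam (v0 T) v) x.
Proof. by rewrite chE => /andP[]; apply: adj_gam. Qed.

Lemma par_ch v x : x \in ch v -> par x = v.
Proof.
move/ch_gam=> e; rewrite /par e; have [p [-> _ _ l]] := gam_cons (v0 T) v.
by rewrite rcons_cons /= belast_rcons /= l.
Qed.

Lemma ch_par x : x != v0 T -> x \in ch (par x).
Proof.
have [p [e vp u l]] := gam_cons (v0 T) x.
case/lastP: p e vp u l => [|p y] e vp u l; first by rewrite -l eqxx.
move=> xn; move: l; rewrite last_rcons => l; subst y.
rewrite /par e /= belast_rcons /=; rewrite rcons_path in vp.
case/andP: vp => vp lx; rewrite inE lx /tlt (adj_neq lx) e.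
by rewrite -rcons_cons mem_rcons inE mem_last orbT.
Qed.

Lemma ch_neq_v0 v x : x \in ch v -> x != v0 T.
Proof. by rewrite chE => /andP[_]; apply: contraNneq => ->; apply: mem_gam_l. Qed.

Lemma adjE v x : adj v x = (x \in ch v) || (v != v0 T) && (x == par v).
Proof.
apply/idP/orP => [vx|[/ch_adj//|/andP[vn /eqP->]]]; last first.
  by rewrite adjC; apply/ch_adj/ch_par.
case: (boolP (x \in gam (v0 T) v)) => xin; last by left; rewrite chE vx.
right; have vch : v \in ch x.
  by rewrite inE adjC vx /tlt eq_sym (adj_neq vx).
by rewrite (ch_neq_v0 vch) (par_ch vch) eqxx.
Qed.

Lemma par_nch v : par v \notin ch v.
Proof.
have [->|vn] := eqVneq v (v0 T).
  by rewrite /par gamxx; apply/negP => /ch_neq_v0; rewrite eqxx.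
have /ch_gam e := ch_par vn.
by rewrite chE negb_and negbK e mem_rcons inE mem_gam_r !orbT.
Qed.

Lemma ch_v0 : ch (v0 T) = [set x | adj (v0 T) x].
Proof. by apply/setP=> x; rewrite [RHS]inE adjE eqxx orbF. Qed.

Lemma tree_ind (P : T -> Prop) : P (v0 T) ->
  (forall v x, P v -> x \in ch v -> P x) -> forall x, P x.
Proof.
move=> P0 Pch x; have [n] := ubnP (size (gam (v0 T) x)).
elim: n x => // n IH x; have [->//|xn] := eqVneq x (v0 T).
rewrite ltnS => sx; apply: Pch (ch_par xn); apply: IH.
by move: sx; rewrite (ch_gam (ch_par xn)) size_rcons.
Qed.

Definition tle w x := w \in gam (v0 T) x.

Lemma tlexx x : tle x x. Proof. exact: mem_gam_r. Qed.
Lemma tle0x x : tle (v0 T) x. Proof. exact: mem_gam_l. Qed.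

Lemma tle_trans : transitive tle.
Proof.
move=> y x z xy /gam_split[p1 [p2 [e1 e2 e]]].
by rewrite /tle e -cat_cons mem_cat -e1 [x \in _]xy.
Qed.

Lemma ch_tle v x : x \in ch v -> tle v x.
Proof. by rewrite inE => /andP[_ /andP[]]. Qed.

Lemma tltE x y : tlt x y = (x != y) && tle x y. Proof. by []. Qed.

Lemma tle_step w x : tlt w x -> exists w',
  [/\ w' \in ch w, tle w' x & gam w x = w :: gam w' x].
Proof.
case/andP=> wx wle; have [p1 [p2 [e1 e2 e]]] := gam_split wle.
case: p2 => [|w' p2] in e2 e *.
  by have := mem_gam_r w x; rewrite e2 inE eq_sym (negPf wx).
have [p [e3 pp u l]] := gam_cons w x.
move: e3; rewrite e2 => -[e3]; rewrite -{}e3 /= in pp u l.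
have w'x : gam w' x = w' :: p2.
  by case/andP: pp => _ pp; case/andP: u => _ u; rewrite -l gam_path.
exists w'; split; rewrite ?w'x //.
  case/andP: pp => ww' _; rewrite chE ww' e1.
  have := gam_uniq (v0 T) x; rewrite e -cat_cons cat_uniq => /and3P[_ h _].
  by apply: contra h => ?; apply/hasP; exists w'; rewrite ?mem_head.
by rewrite /tle e -cat_cons mem_cat mem_head orbT.
Qed.

(** The edge from [v] to [v'] cuts the tree in two parts, so the paths to [x]
    from its two ends differ by that edge. If [x] is not above [v'], the walk
    from [v] to [x] through the root shows that [x] is on the side of [v]. *)
Lemma gam_ch v v' x : v' \in ch v ->
  if tle v' x then gam v x = v :: gam v' x else gam v' x = v' :: gam v x.
Proof.
move=> v'v; case: ifPn => v'x.
  have [w' [w'v w'x ->]] : exists w', [/\ w' \in ch v, tle w' x & gam v x = v :: gam w' x].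
    apply: tle_step; apply/andP; split; last exact: tle_trans (ch_tle v'v) v'x.
    apply: contraTneq v'x => <-; move: v'v; rewrite chE => /andP[_ //].
  suff -> : w' = v' by [].
  have [p1 [p2 [e1 _ e]]] := gam_split v'x.
  have [p3 [p4 [e3 _ e']]] := gam_split w'x.
  move: e1 e3; rewrite (ch_gam v'v) (ch_gam w'v).
  move: e'; rewrite e; have [p [-> _ _ _]] := gam_cons (v0 T) v.
  rewrite !rcons_cons => -[e'] [e1] [e3].
  have : take (size (rcons p v')) (p1 ++ p2) = p1 by rewrite e1 take_size_cat.
  rewrite e' -e3 size_rcons -(size_rcons p w') take_size_cat // => e5.
  by move: e1; rewrite -e5 => /rcons_inj[->].
have [p [e vp u l]] := gam_cons v x; rewrite e -{1}l.
have := @gam_path v' (v :: p); rewrite /= => -> //.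
  by rewrite adjC ch_adj.
rewrite -[(v \notin p) && _]/(uniq (v :: p)) u andbT.
apply: contra v'x => v'p.
(* The walk from [v] down to the root and up to [x] avoids [v']. *)
have [r [er rp ur lr]] := gam_cons (v0 T) v.
have [s [es sp us ls]] := gam_cons (v0 T) x.
have wp : path (@adj T) v (rev (belast (v0 T) r) ++ s).
  rewrite cat_path -{1}lr rev_path (eq_path (e' := @adj T)) ?rp; last first.
    by move=> a b; rewrite /= adjC.
  rewrite -lr; case: (lastP r) => [|r' b] //=.
  by rewrite belast_rcons last_rcons rev_cons last_rcons.
have lw : last v (rev (belast (v0 T) r) ++ s) = x.
  rewrite last_cat -lr; case: (lastP r) => [|r' b] //=.
  by rewrite belast_rcons last_rcons rev_cons last_rcons.
have := gam_sub_walk wp; rewrite lw => /(_ v'); rewrite e v'p => /(_ isT).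
rewrite -cat_cons mem_cat /tle es => /orP[|]; last first.
  by rewrite [in X in _ -> X]inE => ->; rewrite orbT.
move: v'v; rewrite chE er => /andP[_ /negPf v'n].
rewrite -{1}lr -rev_rcons -lastI => v'r.
by move: v'n; rewrite -mem_rev v'r.
Qed.

End Tree.

(** * Multiplicities along edges *)

Section Multiplicities.

Variable T : decorated_tree.
Implicit Types x y v w u al : T.

Definition qq v x : int := q [set v; x] v.

Definition Qn v w : int := \prod_(x | adj v x && (x != w)) qq v x.

Lemma QE v w : Q [set v; w] v = Qn v w.
Proof.
rewrite /Q prod_edges_at; apply: eq_bigl => x; congr (_ && ~~ _).
by apply/eqP/eqP => [/set2_inj|->].
Qed.

Lemma detE v w : det v w = qq v w * qq w v - Qn v w * Qn w v.
Proof.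
by rewrite /det /= QE -(QE w v) /qq [[set w; v]]setUC.
Qed.

Local Arguments path_edges : simpl never.

Lemma path_edges_cons v w p :
  path_edges (v :: w :: p) = [set v; w] :: path_edges (w :: p).
Proof. by []. Qed.

Lemma mem_path_edges (z : seq T) e u : e \in path_edges z -> u \in e -> u \in z.
Proof.
case: z => //= x p; elim: p x => //= y p IH x.
rewrite path_edges_cons inE => /orP[/eqP->|].
  by rewrite !inE orbA => ->.
by move=> ep ue; rewrite inE (IH _ ep ue) orbT.
Qed.

Lemma notin_path_edges (z : seq T) u x : u \notin z -> [set u; x] \notin path_edges z.
Proof. by apply: contra => /mem_path_edges; apply; rewrite set21. Qed.

(** For the path [z] from [w] to an arrow, with [v] a neighbour of [w] that is
    not on [z], this is the factor common to the contributions of the arrow to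
    [mult v] and [mult w]: leaving out the edge between [v] and [w] makes it
    independent of the starting point. *)
Definition offpath (z : seq T) v : int :=
  \prod_(u <- z) \prod_(x | [&& adj u x, [set u; x] \notin path_edges z
                              & [set u; x] != [set v; head v z]]) qq u x.

Lemma xmultE v al : xmult v al =
  \prod_(u <- gam v al)
    \prod_(x | adj u x && ([set u; x] \notin path_edges (gam v al))) qq u x.
Proof.
rewrite /xmult (exchange_big_dep (mem (gam v al))) /=; last by move=> e u _ /andP[].
rewrite big_uniq ?gam_uniq //=; apply: eq_bigr => u uin.
rewrite -(prod_edges_at _ (fun e => e \notin path_edges (gam v al)) (fun e => q e u)).
by apply: eq_bigl => e; rewrite uin !andbT -!andbA; congr (_ && _); rewrite andbC.
Qed.

Lemma set2_eqr v x w : ([set v; x] == [set v; w]) = (x == w).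
Proof. by apply/eqP/eqP => [/set2_inj|->]. Qed.

Lemma set2_neq u x v w : u != v -> u != w -> [set u; x] != [set v; w].
Proof.
move=> uv uw; apply/eqP => e; have := set21 u x.
by rewrite e !inE (negPf uv) (negPf uw).
Qed.

Lemma xmult_head v w p al : gam v al = v :: w :: p ->
  xmult v al = Qn v w * offpath (w :: p) v.
Proof.
move=> e; have := gam_uniq v al; rewrite xmultE e cons_uniq => /andP[vn u].
rewrite big_cons; congr (_ * _).
  apply: eq_bigl => x; congr (_ && _).
  by rewrite path_edges_cons in_cons set2_eqr negb_or notin_path_edges ?andbT.
apply: eq_bigr => y _; apply: eq_bigl => x.
by rewrite path_edges_cons in_cons negb_or [X in _ && X]andbC.
Qed.

Lemma xmult_tail v w p al : adj v w -> v \notin w :: p -> gam w al = w :: p ->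
  xmult w al = qq w v * offpath (w :: p) v.
Proof.
move=> vw vn e; have := gam_uniq w al; rewrite xmultE e cons_uniq => /andP[wn u].
rewrite /offpath !big_cons mulrA; congr (_ * _).
  rewrite (bigD1 v) /=; last first.
    by rewrite adjC vw setUC notin_path_edges.
  congr (_ * _); apply: eq_bigl => x; rewrite -andbA; congr (_ && (_ && _)).
  by rewrite [[set v; w]]setUC set2_eqr.
apply: eq_big_seq => y yp; apply: eq_bigl => x.
rewrite (@set2_neq y x v w) ?andbT //.
  by apply: contraNneq vn => <-; rewrite inE yp orbT.
by apply: contraNneq wn => <-.
Qed.

Lemma offpath_step v w w' p : v \notin w' :: p -> w \notin w' :: p ->
  offpath (w :: w' :: p) v =
  (\prod_(x | [&& adj w x, x != v & x != w']) qq w x) * offpath (w' :: p) w.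
Proof.
move=> vn wn; rewrite /offpath big_cons; congr (_ * _).
  apply: eq_bigl => x; congr (_ && _).
  rewrite path_edges_cons in_cons set2_eqr negb_or notin_path_edges ?andbT // andbC.
  by rewrite [[set v; w]]setUC set2_eqr.
apply: eq_big_seq => y yp; apply: eq_bigl => x.
rewrite (@set2_neq y x v w) ?andbT ?path_edges_cons ?in_cons ?negb_or.
- by rewrite andbC; case: (adj y x) => //=; rewrite ?andbF // andbT andbC.
- by apply: contraNneq vn => <-.
by apply: contraNneq wn => <-.
Qed.

(** The part of the multiplicities that depends only on the tree above [w];
    it satisfies the recursion [Yup_ch]. *)
Definition Yup w : int :=
  \sum_(al in arrows1 T | tle w al) offpath (gam w al) (par w).

Definition Qup w : int := \prod_(x in ch w) qq w x.

Definition Qsib w w' : int := \prod_(x in ch w | x != w') qq w x.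

Lemma adj_par w x : adj w x && (x != par w) = (x \in ch w).
Proof.
rewrite adjE; case xch: (x \in ch w) => /=.
  by apply: contraTneq xch => ->; apply: par_nch.
by case: (x == par w); rewrite /= ?andbF.
Qed.

Lemma Qn_ch w w' : w' \in ch w -> Qn w' w = Qup w'.
Proof.
by move=> w'w; apply: eq_bigl => x; rewrite -[w in _ != w](par_ch w'w) adj_par.
Qed.

(** On both sides of the edge, each arrow contributes a common factor, so that
    eliminating the arrows that are not above [w] leaves the determinant. *)
Lemma mult_edge v w : w \in ch v ->
  qq v w * mult w = Qup w * mult v + det v w * Yup w.
Proof.
move=> wv; apply/eqP; rewrite addrC -subr_eq; apply/eqP.
rewrite /mult /Yup [X in _ = _ * X]big_mkcondr /= !mulr_sumr -sumrB.
apply: eq_bigr => al al1; have := gam_ch al wv; case: ifP => _ e.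
  have [p [ep _ _ _]] := gam_cons w al; rewrite ep in e.
  have vn : v \notin w :: p by have := gam_uniq v al; rewrite e => /andP[].
  rewrite (xmult_head e) (xmult_tail (ch_adj wv) vn ep) ep (par_ch wv) detE.
  by rewrite (Qn_ch wv); ring.
have [p [ep _ _ _]] := gam_cons v al; rewrite ep in e.
have wn : w \notin v :: p by have := gam_uniq w al; rewrite e => /andP[].
rewrite (xmult_head e) (xmult_tail _ wn ep); last by rewrite adjC ch_adj.
by rewrite (Qn_ch wv); ring.
Qed.

(** All arrows are above the root. *)
Lemma mult_v0 : mult (v0 T) = Yup (v0 T).
Proof.
rewrite /mult /Yup [RHS]big_mkcondr /=; apply: eq_bigr => al _.
rewrite tle0x xmultE /offpath; apply: eq_bigr => u _; apply: eq_bigl => x.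
have -> : par (v0 T) = v0 T by rewrite /par gamxx.
have [p [-> _ _ _]] := gam_cons (v0 T) al; rewrite /= setUid.
case ux: (adj u x) => //=; rewrite andbC; case: eqP => // e.
by have := adj_neq ux; move/edges_card2: ux; rewrite e cards1.
Qed.

Lemma tle_ch_uniq v w w' x : w \in ch v -> w' \in ch v -> tle w x -> tle w' x ->
  w = w'.
Proof.
move=> wv w'v wx w'x; have := gam_ch x wv; have := gam_ch x w'v.
rewrite wx w'x; have [p [-> _ _ _]] := gam_cons w x.
by have [p' [-> _ _ _]] := gam_cons w' x; move=> -> [].
Qed.

(** The (1)-arrows above [w] are distributed among its children. *)
Lemma Yup_ch w : w \notin arrows1 T ->
  Yup w = \sum_(w' in ch w) Qsib w w' * Yup w'.
Proof.
move=> wn1; rewrite /Yup.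
under [RHS]eq_bigr => w' w'w do rewrite mulr_sumr.
rewrite (exchange_big_dep (fun al => (al \in arrows1 T) && tle w al)) /=; last first.
  move=> w' al /ch_tle ww' /andP[-> w'al]; exact: tle_trans ww' w'al.
apply: eq_bigr => al /andP[al1 wal].
have wal' : tlt w al by rewrite tltE wal andbT; apply: contraNneq wn1 => ->.
have [w' [w'w w'al e]] := tle_step wal'.
rewrite (big_pred1 w'); last first.
  move=> x /=; rewrite al1 /=; apply/andP/eqP => [[xw xal]|->//].
  exact: tle_ch_uniq xw w'w xal w'al.
have [p [ep _ _ _]] := gam_cons w' al; rewrite e ep (par_ch w'w).
have wn : w \notin w' :: p by have := gam_uniq w al; rewrite e ep => /andP[].
rewrite offpath_step //.
  congr (_ * _); apply: eq_bigl => x.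
  by rewrite andbA adj_par.
have [wE|wn0] := eqVneq w (v0 T).
  rewrite wE.
  have -> : par (v0 T) = v0 T by rewrite /par gamxx.
  by rewrite -wE.
rewrite -ep; have := gam_ch al (ch_par wn0); rewrite wal e.
by move=> ee; have := gam_uniq (par w) al; rewrite ee /= inE negb_or => /andP[/andP[_ ->]].
Qed.

Lemma arrow_ch w x : w \in arrows T -> x \notin ch w.
Proof.
rewrite !inE valencyE => /andP[wn /cards1P[y e]]; apply: contraL (par_nch w) => xw.
have /set1P -> : par w \in [set y] by rewrite -e inE adjE wn eqxx orbT.
have /set1P <- : x \in [set y] by rewrite -e inE; case/andP: xw.
by rewrite negbK inE.
Qed.

Lemma tle_arrow w x : w \in arrows T -> tle w x -> x = w.
Proof.
move=> wa wx; apply/eqP; rewrite eq_sym; apply: contraT => wnx.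
have [|w' [w'w _ _]] := @tle_step _ w x; first by rewrite tltE wnx.
by rewrite (negPf (arrow_ch _ wa)) in w'w.
Qed.

Lemma Yup_arrow1 w : w \in arrows1 T -> Yup w = 1.
Proof.
move=> w1; have wa : w \in arrows T by move: w1; rewrite inE => /andP[].
rewrite /Yup (big_pred1 w) => [|x].
  rewrite /offpath gamxx big_seq1 /=; apply: big1 => x.
  rewrite [[set par w; w]]setUC set2_eqr adj_par /= => xw.
  by have := arrow_ch x wa; rewrite xw.
rewrite /=; apply/andP/eqP => [[_]|->]; first exact: tle_arrow.
by rewrite tlexx.
Qed.

Lemma Yup_arrow0 w : w \in arrows0 T -> Yup w = 0.
Proof.
move=> w0; have wa : w \in arrows T by move: w0; rewrite inE => /andP[].
apply: big1 => x /andP[x1 /(tle_arrow wa) xw].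
by move: x1; rewrite xw inE w0.
Qed.

End Multiplicities.

(** * Newton trees *)

Section Newton.

Variable T : decorated_tree.
Hypothesis NT : newton_tree T.
Implicit Types x y v w u b : T.

Lemma tree_down_ind (P : T -> Prop) :
  (forall v, (forall x, x \in ch v -> P x) -> P v) -> forall v, P v.
Proof.
move=> IH v; have [n] := ubnP (#|T| - size (gam (v0 T) v)).
elim: n v => // n IHn v sv; apply: IH => x xv; apply: IHn.
have : (size (gam (v0 T) x) <= #|T|)%N.
  by rewrite -(card_uniqP (gam_uniq _ _)) max_card.
by move: sv; rewrite (ch_gam xv) size_rcons; lia.
Qed.

Lemma vertexN v : (v \in vertices T) = (v \notin arrows T).
Proof. by rewrite inE. Qed.

Lemma v0_vertex : v0 T \in vertices T.
Proof. by rewrite !inE eqxx. Qed.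

Lemma ch_vertex v x : x \in ch v -> v \in vertices T.
Proof. by rewrite vertexN; apply: contraL => va; apply: arrow_ch. Qed.

Lemma arrows0_arrow b : b \in arrows0 T -> b \in arrows T.
Proof. by rewrite inE => /andP[]. Qed.

Lemma arrows1_arrow b : b \in arrows1 T -> b \in arrows T.
Proof. by rewrite inE => /andP[]. Qed.

Lemma arrows01 b : b \in arrows0 T -> b \notin arrows1 T.
Proof. by rewrite [b \in arrows1 T]inE => ->. Qed.

Lemma arrow_adj v x : x \in arrows T -> adj v x -> x \in ch v.
Proof.
move=> xa; rewrite adjE => /orP[//|/andP[vn /eqP e]].
by move: (ch_par vn); rewrite -e (negPf (arrow_ch _ xa)).
Qed.

Lemma EplusE v : Eplus v = [set [set v; x] | x in ch v].
Proof.
apply/setP=> e; rewrite inE; apply/andP/imsetP.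
  case=> eE /existsP[x /andP[/eqP ee vx]]; exists x => //.
  by rewrite inE vx andbT /adj /edge_rel -ee.
case=> x; rewrite inE => /andP[vx vltx] ->; split=> //.
by apply/existsP; exists x; rewrite eqxx.
Qed.

Lemma mem_Eplus v x : x \in ch v -> [set v; x] \in Eplus v.
Proof. by move=> xv; rewrite EplusE; apply: imset_f. Qed.

Lemma qq_ge1 v x : x \in ch v -> 1 <= qq v x.
Proof.
by move=> xv; apply: (newton_Eplus_ge1 NT) (ch_vertex xv) (mem_Eplus xv).
Qed.

Lemma qq_eq1 v x y : x \in ch v -> y \in ch v -> x != y -> 1 < qq v y ->
  qq v x = 1.
Proof.
move=> xv yv xy qy; apply/eqP; rewrite eq_le qq_ge1 // andbT leNgt.
apply/negP => qx; have := newton_Eplus_gt1 NT (ch_vertex xv).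
rewrite leqNgt => /negP; apply; apply/card_gt1P.
by exists [set v; x], [set v; y]; split; rewrite ?set2_eqr // inE mem_Eplus.
Qed.

Lemma dead_endE v b : b \in arrows0 T -> b \in ch v -> dead_end [set v; b].
Proof.
move=> b0 /ch_adj vb; rewrite /dead_end [_ \in edges T]vb.
by apply/existsP; exists b; rewrite b0 set22.
Qed.

Lemma dead_endP v e : v \in vertices T -> dead_end e -> v \in e ->
  exists b, [/\ b \in arrows0 T, b \in ch v & e = [set v; b]].
Proof.
move=> vv /andP[eE /existsP[b /andP[b0 be]]] ve.
have /edgeP[x vx ex] : (e \in edges T) && (v \in e) by rewrite eE.
move: be; rewrite ex !inE => /orP[]/eqP eb; first by rewrite -eb inE arrows0_arrow in vv.
by subst x; exists b; split=> //; apply: arrow_adj (arrows0_arrow b0) vx.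
Qed.

Lemma arrows0_uniq v b b' : b \in arrows0 T -> b \in ch v ->
  b' \in arrows0 T -> b' \in ch v -> b = b'.
Proof.
move=> b0 bv b0' bv'; apply: contraTeq (newton_dead_end_unique NT (ch_vertex bv)).
move=> bb'; rewrite -ltnNge; apply/card_gt1P.
by exists [set v; b], [set v; b']; rewrite !inE !dead_endE ?set2_eqr ?eqxx.
Qed.

Lemma qq_dead v b x : b \in arrows0 T -> b \in ch v -> x \in ch v ->
  qq v x <= qq v b.
Proof.
move=> b0 bv xv; rewrite /qq.
rewrite (newton_dead_end_max NT (ch_vertex bv) (dead_endE b0 bv)) ?set21 //.
by rewrite (bigD1 _ (mem_Eplus xv)) /= le_max lexx.
Qed.

Lemma qq_dead1 v b x : b \in arrows0 T -> b \in ch v -> x \in ch v -> x != b ->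
  qq v x = 1.
Proof.
move=> b0 bv xv xb; apply/eqP; rewrite eq_le qq_ge1 // andbT leNgt.
apply/negP => qx; have := qq_dead b0 bv xv.
by rewrite (qq_eq1 bv xv) 1?eq_sym // leNgt qx.
Qed.

Lemma a_dead v b : b \in arrows0 T -> b \in ch v -> a_ v = qq v b.
Proof.
move=> b0 bv; rewrite /a_; case: pickP => [e /andP[de ve]|/(_ [set v; b])].
  have [b' [b0' bv' ->]] := dead_endP (ch_vertex bv) de ve.
  by rewrite (arrows0_uniq b0' bv' b0 bv).
by rewrite dead_endE ?set21.
Qed.

Lemma a_nodead v : v \in vertices T -> [disjoint ch v & arrows0 T] -> a_ v = 1.
Proof.
move=> vv d; rewrite /a_; case: pickP => // e /andP[de ve].
have [b [b0 bv _]] := dead_endP vv de ve.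
by have := disjointFr d bv; rewrite b0.
Qed.

Variant a_spec v : int -> Prop :=
  | ADead b of b \in arrows0 T & b \in ch v : a_spec v (qq v b)
  | ANoDead of (forall x, x \in ch v -> x \notin arrows0 T) : a_spec v 1.

Lemma aP v : v \in vertices T -> a_spec v (a_ v).
Proof.
move=> vv; have [/pred0P d|/pred0Pn[b /andP[/= bv b0]]] :=
    boolP [disjoint ch v & arrows0 T].
  rewrite a_nodead //; last exact/pred0P.
  by constructor=> x xv; have := d x; rewrite /= xv /= => ->.
by rewrite (a_dead b0 bv); constructor.
Qed.

Lemma a_ge1 v : v \in vertices T -> 1 <= a_ v.
Proof. by case/aP=> // b b0 bv; apply: qq_ge1. Qed.

Lemma Qsib_ge1 v x : 1 <= Qsib v x.
Proof.
apply: (big_ind (fun z : int => 1 <= z)) => // [a b|y /andP[yv _]]; last exact: qq_ge1.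
by move=> a1 b1; nia.
Qed.

Lemma Qup_sib v x : x \in ch v -> Qup v = qq v x * Qsib v x.
Proof. by move=> xv; rewrite /Qup (bigD1 x). Qed.

Lemma Qup_ge1 v : 1 <= Qup v.
Proof.
apply: (big_ind (fun z : int => 1 <= z)) => // [a b|y]; last exact: qq_ge1.
by move=> a1 b1; nia.
Qed.

(** The dead end carries the maximal decoration, and at most one decoration
    differs from 1. *)
Lemma Qup_dead v b : b \in arrows0 T -> b \in ch v -> Qup v = a_ v.
Proof.
move=> b0 bv; rewrite (Qup_sib bv) (a_dead b0 bv) [Qsib v b]big1 ?mulr1 //.
by move=> x /andP[xv xb]; apply: qq_dead1 b0 bv xv xb.
Qed.

Lemma Qsib_dead v b x : b \in arrows0 T -> b \in ch v -> x \in ch v ->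
  x != b -> Qsib v x = a_ v.
Proof.
move=> b0 bv xv xb; rewrite -(Qup_dead b0 bv) (Qup_sib xv).
by rewrite (qq_dead1 b0 bv xv xb) mul1r.
Qed.

Lemma Qsib_ge_a v x : x \in ch v -> x \notin arrows0 T -> a_ v <= Qsib v x.
Proof.
move=> xv x0; case: (aP (ch_vertex xv)) => [b b0 bv|_]; last exact: Qsib_ge1.
have xb : x != b by apply: contraNneq x0 => ->.
by rewrite (Qsib_dead b0 bv xv xb) (a_dead b0 bv).
Qed.

Lemma ch_one_above v : v \in vertices T -> exists2 x, x \in ch v & x \notin arrows0 T.
Proof.
move=> vv; have [al al1 val] := newton_one_above NT vv.
have [x [xv xal _]] := tle_step val; exists x => //.
apply/negP => x0; have := arrows01 x0.
by rewrite -(tle_arrow (arrows0_arrow x0) xal) al1.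
Qed.

(** Every vertex has a (1)-arrow above it, and decorations on the way up are
    at least 1. *)
Lemma Yup_ge x : (x \in arrows0 T) = false -> 1 <= Yup x.
Proof.
elim/tree_down_ind: x => v IH v0F.
have [v1|v1] := boolP (v \in arrows1 T); first by rewrite Yup_arrow1.
have vv : v \in vertices T.
  by rewrite vertexN; apply: contra v1 => va; rewrite inE va v0F.
have [x xv x0] := ch_one_above vv; rewrite Yup_ch // (bigD1 x) //=.
have Yx := IH x xv (negPf x0); have Qx := Qsib_ge1 v x.
have QYx : 1 <= Qsib v x * Yup x by nia.
apply: le_trans QYx _; rewrite lerDl; apply: sumr_ge0 => y /andP[yv _]; have Qy := Qsib_ge1 v y.
case y0: (y \in arrows0 T); first by rewrite Yup_arrow0 ?mulr0.
by have := IH y yv y0; nia.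
Qed.

Lemma Yup_ge0 x : 0 <= Yup x.
Proof.
by case x0: (x \in arrows0 T); [rewrite Yup_arrow0|have := Yup_ge x0; lia].
Qed.

Lemma Yup_vertex v : v \in vertices T -> 1 <= Yup v.
Proof.
move=> vv; apply: Yup_ge; apply: contraTF vv => /arrows0_arrow.
by rewrite vertexN negbK.
Qed.

Lemma vertex_arrows1 v : v \in vertices T -> v \notin arrows1 T.
Proof. by rewrite vertexN; apply: contra => /arrows1_arrow. Qed.

Lemma Yup_ge_ch v x : x \in ch v -> Qsib v x * Yup x <= Yup v.
Proof.
move=> xv; rewrite [Yup v]Yup_ch ?vertex_arrows1 ?(ch_vertex xv) // (bigD1 x) //=.
rewrite lerDl; apply: sumr_ge0 => y _.
by have := Qsib_ge1 v y; have := Yup_ge0 y; nia.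
Qed.

Lemma Yup_ge_a v : v \in vertices T ->
  a_ v * (\sum_(x in ch v) Yup x) <= Yup v.
Proof.
move=> vv; rewrite [Yup v]Yup_ch ?vertex_arrows1 // mulr_sumr.
apply: ler_sum => x xv; case x0: (x \in arrows0 T).
  by rewrite Yup_arrow0 ?mulr0.
by have := Qsib_ge_a xv (negbT x0); have := Yup_ge0 x; nia.
Qed.

Lemma mult_v0_gt0 : 0 < mult (v0 T).
Proof. by rewrite mult_v0; have := Yup_vertex v0_vertex; lia. Qed.

Lemma qq_v0 x : x \in ch (v0 T) -> qq (v0 T) x = 1.
Proof.
move=> /ch_adj vx; apply: (newton_q_root NT); last exact: set21.
exact: vx.
Qed.

Lemma det_le v w : w \in ch v -> w \in vertices T -> det v w <= -1.
Proof.
by move=> wv ww; have := newton_det NT (ch_vertex wv) ww (ch_adj wv); lia.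
Qed.

Lemma valency_ch v : v != v0 T -> valency v = #|ch v|.+1.
Proof.
move=> vn; rewrite valencyE (_ : [set x | adj v x] = par v |: ch v).
  by rewrite cardsU1 par_nch.
by apply/setP=> x; rewrite in_setU1 [LHS]inE adjE vn orbC.
Qed.

End Newton.

(** * Minimally complete trees *)

Section Complete.

Variable T : decorated_tree.
Hypothesis NT : newton_tree T.
Hypothesis MC : minimally_complete T.
Implicit Types x y v w u b : T.

Lemma dic_vertex u : u \in dicriticals T -> u \in vertices T.
Proof. by rewrite inE => /andP[]. Qed.

Lemma dic_mult u : u \in dicriticals T -> mult u = 0.
Proof. by rewrite inE => /andP[_ /eqP]. Qed.

Lemma calN_vertex v : v \in calN T -> v \in vertices T.
Proof. by rewrite inE => /andP[]. Qed.

Lemma calN_gt0 v : v \in calN T -> 0 < mult v.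
Proof. by rewrite inE => /andP[]. Qed.

Lemma vertex_split v : v \in vertices T -> (v \in calN T) = (v \notin dicriticals T).
Proof.
move=> vv; rewrite [v \in calN T]inE [v \in dicriticals T]inE vv /=.
by rewrite lt0r mc_mult_ge0 ?andbT.
Qed.

Lemma calN_ndic v : v \in calN T -> v \notin dicriticals T.
Proof. by move=> vN; rewrite -vertex_split ?calN_vertex. Qed.

Lemma v0_calN : v0 T \in calN T.
Proof. by rewrite inE v0_vertex mult_v0_gt0. Qed.

Lemma dic_neq_v0 u : u \in dicriticals T -> u != v0 T.
Proof. by apply: contraTneq => ->; apply: calN_ndic v0_calN. Qed.

(** As [det] is negative, [mult_edge] would make the multiplicity negative at a
    vertex above a dicritical. *)
Lemma dic_ch u x : u \in dicriticals T -> x \in ch u -> x \in arrows T.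
Proof.
move=> ud xu; apply: contraT; rewrite -vertexN => xv.
have := mult_edge xu; rewrite (dic_mult ud) mulr0 add0r.
have := det_le NT xu xv; have := Yup_vertex NT xv; have := qq_ge1 NT xu.
by have := mc_mult_ge0 MC xv; nia.
Qed.

Lemma calN_par v w : w \in ch v -> w \in vertices T -> v \in calN T.
Proof.
move=> wv ww; rewrite vertex_split ?(ch_vertex wv) //; apply/negP => vd.
by have := dic_ch vd wv; rewrite -[_ \in arrows T]negbK -vertexN ww.
Qed.

Lemma arrow1_par x v : x \in arrows1 T -> x \in ch v -> v \in dicriticals T.
Proof.
move=> x1 xv; have [u ud ux] := mc_arrows1 MC x1; rewrite adjC in ux.
by rewrite -(par_ch xv) (par_ch (arrow_adj (arrows1_arrow x1) ux)).
Qed.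

(** The parent of [v] is left out, so that [#|cN v|] is the number of branches
    of [calN T] that start at [v], for the root as for the other vertices. *)
Definition cN v : {set T} := [set x in ch v | x \in calN T].

Lemma dic_atE v : v \in vertices T -> dic_at v = [set x in ch v | x \in dicriticals T].
Proof.
move=> vv; apply/setP=> u; rewrite [LHS]inE [RHS]inE adjE.
case ud: (u \in dicriticals T); rewrite ?andbF //= andbT.
case uv: (u \in ch v) => //=; apply/andP => -[vn /eqP e].
have := calN_par (ch_par vn) vv; rewrite -e => /calN_ndic; by rewrite ud.
Qed.

Lemma ch_cases v x : v \in calN T -> x \in ch v ->
  [|| x \in cN v, x \in dic_at v | x \in arrows0 T].
Proof.
move=> vN xv; rewrite dic_atE ?calN_vertex // [x \in cN v]inE [x \in [set _ in _ | _]]inE xv /=.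
have [xa|xv'] := boolP (x \in arrows T).
  apply/orP; right; apply/orP; right; apply: contraT => x0.
  have x1 : x \in arrows1 T by rewrite inE x0.
  by have := arrow1_par x1 xv; rewrite (negPf (calN_ndic vN)).
rewrite -vertexN in xv'; rewrite vertex_split //.
by case: (x \in dicriticals T).
Qed.

Lemma cN_ch v x : x \in cN v -> x \in ch v.
Proof. by rewrite inE => /andP[]. Qed.

Lemma cN_calN v x : x \in cN v -> x \in calN T.
Proof. by rewrite inE => /andP[]. Qed.

Lemma dic_at_ch v x : v \in vertices T -> x \in dic_at v -> x \in ch v.
Proof. by move=> vv; rewrite dic_atE // inE => /andP[]. Qed.

Lemma dic_at_dic v x : x \in dic_at v -> x \in dicriticals T.
Proof. by rewrite inE => /andP[]. Qed.

Lemma par_calN v : v \in calN T -> v != v0 T -> par v \in calN T.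
Proof. by move=> vN vn; apply: calN_par (ch_par vn) (calN_vertex vN). Qed.

Lemma epsilonE v : v \in calN T -> epsilon v = (#|cN v| + (v != v0 T))%N.
Proof.
move=> vN; rewrite /epsilon; have [->|vn] := eqVneq v (v0 T).
  rewrite addn0; apply: eq_card => x.
  by rewrite [LHS]inE [RHS]inE adjE eqxx orbF andbC.
rewrite addn1 (_ : [set x in calN T | adj v x] = par v |: cN v).
  by rewrite cardsU1 [_ \in cN v]inE (negPf (par_nch v)).
apply/setP=> x; rewrite in_setU1 [LHS]inE [x \in cN v]inE adjE vn andb_orr orbC /=.
rewrite andbC; congr (_ || _); first by case: eqP => //= ->; rewrite par_calN.
by rewrite andbC.
Qed.

Lemma ch_card_ge2 v : v \in vertices T -> v != v0 T -> (2 <= #|ch v|)%N.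
Proof.
move=> vv vn; have := mc_valency MC vv vn; move: vv.
by rewrite vertexN /arrows in_setD1 vn inE valency_ch //; case: #|ch v| => [|[]].
Qed.

(** The child of a vertex [v <> v0] carrying all of [Qup v] may be a dead end,
    in which case it can be dropped; otherwise [v] has two branches and [Qup v]
    is carried by at most one of them. *)
Lemma Qup_le_Yup v : v \in vertices T -> v != v0 T -> Qup v <= Yup v.
Proof.
move=> vv vn; case: (aP NT vv) (erefl (a_ v)) => [b b0 bv _|nd _].
  have [x xv x0] := ch_one_above NT vv.
  rewrite (Qup_dead NT b0 bv) -(Qsib_dead NT b0 bv xv); last first.
    by apply: contraNneq x0 => ->.
  by have := Yup_ge_ch NT xv; have := Yup_ge NT (negPf x0); have := Qsib_ge1 NT v x; nia.
have /card_gt1P[x [y [xv yv xy]]] := ch_card_ge2 vv vn.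
wlog qx : x y xv yv xy / qq v x = 1 => [W|].
  have [qy|qy] := ltP 1 (qq v y); first exact: W xy (qq_eq1 NT xv yv xy qy).
  by apply: (W y x); rewrite // 1?eq_sym //; apply/eqP; rewrite eq_le qy qq_ge1.
have := Qup_sib xv; rewrite qx mul1r => ->.
by have := Yup_ge_ch NT xv; have := Yup_ge NT (negPf (nd x xv)); have := Qsib_ge1 NT v x; nia.
Qed.

(** By [mult_edge] and [Qup w <= Yup w], multiplicity 1 at [v] would drop to at
    most 0 at [w]. *)
Lemma mult_ge2 v w : w \in cN v -> 2 <= mult v.
Proof.
move=> wc; have wv := cN_ch wc; have wN := cN_calN wc; have ww := calN_vertex wN.
have vN := calN_par wv ww; have := mult_edge wv; have := qq_ge1 NT wv.
have := Qup_le_Yup ww (ch_neq_v0 wv); have := det_le NT wv ww.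
have := calN_gt0 wN; have := calN_gt0 vN; have := Qup_ge1 NT w.
move: (mult v) (mult w) (qq v w) (Qup w) (Yup w) (det v w) => N M q P Y d.
move=> P1 N1 M1 d1 PY q1 e.
have [//|N2] := leP 2 N; have N1' : N = 1 by lia.
subst N; have : 0 < q * M by nia.
by nia.
Qed.

Lemma dead_v0 x : x \in ch (v0 T) -> x \notin arrows0 T.
Proof.
move=> x0; apply/negP => xA; have := mc_dead_end1 MC (v0_vertex T) (dead_endE xA x0).
by rewrite set21 => /(_ isT (qq_v0 NT x0)); rewrite (negPf (calN_ndic v0_calN)).
Qed.

Lemma a_v0 : a_ (v0 T) = 1.
Proof.
by case: (aP NT (v0_vertex T)) => // b b0 bv; have := dead_v0 bv; rewrite b0.
Qed.

Lemma a_ge2 v b : v \in calN T -> b \in arrows0 T -> b \in ch v -> 2 <= a_ v.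
Proof.
move=> vN b0 bv; have vv := calN_vertex vN.
suff : a_ v != 1 by have := a_ge1 NT vv; lia.
apply: contraTneq (calN_ndic vN) => a1; rewrite negbK.
apply: (mc_dead_end1 MC vv (dead_endE b0 bv)); first exact: set21.
by rewrite -/(qq v b) -(a_dead NT b0 bv).
Qed.

Lemma ch_card v : v \in calN T ->
  #|ch v| = (#|cN v| + #|dic_at v| + (a_ v != 1))%N.
Proof.
move=> vN; have vv := calN_vertex vN.
have -> : ch v = cN v :|: dic_at v :|: [set b in ch v | b \in arrows0 T].
  apply/setP=> x; rewrite !in_setU [x \in [set _ in _ | _]]inE.
  apply/idP/idP => [xv|]; first by have := ch_cases vN xv; rewrite xv -orbA.
  by case/orP=> [/orP[/cN_ch|/(dic_at_ch vv)]|/andP[]].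
rewrite cardsU [_ :&: _](_ : _ = set0) ?cards0 ?subn0; last first.
  apply/setP=> x; rewrite in_setI in_set0; apply/negbTE/negP=> /andP[h].
  rewrite inE => /andP[_ /arrows0_arrow xa]; move: h xa.
  by case/setUP=> [/cN_calN/calN_vertex|/dic_at_dic/dic_vertex]; rewrite vertexN => /negPf->.
congr (_ + _)%N.
  rewrite cardsU [_ :&: _](_ : _ = set0) ?cards0 ?subn0 //.
  apply/setP=> x; rewrite in_setI in_set0; apply/negbTE/negP.
  by case/andP=> /cN_calN/calN_ndic/negP h /dic_at_dic.
case: (aP NT vv) (erefl (a_ v)) => [b b0 bv e|nd _].
  have := a_ge2 vN b0 bv; rewrite (a_dead NT b0 bv) => a2.
  rewrite (_ : [set _ in _ | _] = [set b]) ?cards1; first by case: eqP a2 => // ->.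
  apply/setP=> x; rewrite inE in_set1; apply/andP/eqP => [[xv x0]|->//].
  exact: (arrows0_uniq NT x0 xv b0 bv).
rewrite eqxx; apply: eq_card0 => x; rewrite inE; apply/negP => /andP[/nd xv x0].
by rewrite x0 in xv.
Qed.

Lemma rE v : v \in calN T -> r_ v = (epsilon v)%:Z + #|dic_at v|%:Z - 1.
Proof.
move=> vN; rewrite /r_ [RHS]addrC -PoszD; congr (_ + Posz _).
rewrite /epsilon /dic_at -cardsUI [_ :&: _](_ : _ = set0) ?cards0 ?addn0; last first.
  apply/setP=> x; rewrite in_setI in_set0 inE; apply/negbTE/negP.
  by case/andP=> /andP[/calN_ndic/negP h _] /dic_at_dic.
apply: eq_card => x; rewrite [LHS]inE in_setU [X in X || _]inE [X in _ || X]inE.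
rewrite -andb_orl.
congr (_ && _); apply/idP/orP => [xv|[/calN_vertex|/dic_vertex]//].
by rewrite vertex_split //; case: (x \in dicriticals T); [right|left].
Qed.

(** A sum of nonnegative terms, as each degree divides [mult v]. *)
Definition slack v : int := \sum_(u in dic_at v) (mult v - (deg u)%:Z).

Lemma DeltaE v : v \in calN T ->
  Delta v = ((epsilon v)%:R - 2) * ((mult v)%:~R - 1)
            + (mult v)%:~R * (1 - 1 / (a_ v)%:~R) + (slack v)%:~R.
Proof.
move=> vN; rewrite /Delta rE // /slack.
have -> : (\sum_(u in dic_at v) (mult v - (deg u)%:Z))%:~R =
    \sum_(u in dic_at v) ((mult v)%:~R - (deg u)%:R) :> rat.
  by rewrite rmorph_sum /=; apply: eq_bigr => u _; rewrite rmorphB.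
rewrite !sumrB !sumr_const -[(mult v)%:~R *+ _]mulr_natr rmorphB rmorphD /= -!pmulrn.
by ring.
Qed.

Lemma DeltaE_ch v : v \in calN T -> v != v0 T ->
  Delta v = #|cN v|%:R * ((mult v)%:~R - 1) + 1
            - (mult v)%:~R / (a_ v)%:~R + (slack v)%:~R.
Proof.
by move=> vN vn; rewrite DeltaE // epsilonE // vn /= addn1 -natr1; ring.
Qed.

End Complete.

(** * Divisors with greatest common divisor 1 *)

Section Divisors.

Implicit Types (N d : nat) (s : seq nat).

Lemma dvdn_half N d : (0 < N)%N -> (d %| N)%N -> d != N -> (d.*2 <= N)%N.
Proof.
move=> N0 /dvdnP[[|[|k]] e]; rewrite e ?mul1n ?eqxx //; first by rewrite e in N0.
by move=> _; rewrite !mulSn -addnn addnA leq_addr.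
Qed.

Lemma all_eq_nseq N s : all (pred1 N) s -> s = nseq (size s) N.
Proof. exact: all_pred1P. Qed.

Lemma dvdn_biggcd m s : all (dvdn m) s -> (m %| \big[gcdn/0%N]_(d <- s) d)%N.
Proof.
elim: s => [|d s IH]; first by rewrite big_nil dvdn0.
by case/andP=> md ms; rewrite big_cons dvdn_gcd md IH.
Qed.

(** Two proper divisors miss at least [N / 2] each. With a single one, it equals
    the greatest common divisor. *)
Lemma gcd1_slack N s : (0 < N)%N -> s != [::] -> all (dvdn^~ N) s ->
    \big[gcdn/0%N]_(d <- s) d = 1%N -> sorted leq s ->
  (exists k, s = 1%N :: nseq k N) \/ (N <= \sum_(d <- s) (N - d))%N.
Proof.
move=> N0 sn /allP sN g so.
have [sE|/allPn[d0 d0s d0N]] := boolP (all (pred1 N) s).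
  have N1 : N = 1%N.
    apply/eqP; rewrite -dvdn1 -g; apply: dvdn_biggcd; apply/allP => d ds.
    by have /eqP -> := allP sE d ds.
  left; exists (size s).-1; rewrite [LHS](all_eq_nseq sE) N1.
  by case: s sn {sN g so sE}.
have ps := perm_to_rem d0s; set s' := rem d0 s in ps.
have [sE|/allPn[d1 d1s d1N]] := boolP (all (pred1 N) s').
  have d01 : d0 = 1%N.
    apply/eqP; rewrite -dvdn1 -g; apply: dvdn_biggcd; apply/allP => d.
    rewrite (perm_mem ps) inE => /orP[/eqP->//|ds].
    by have /eqP -> := allP sE d ds; apply: sN.
  left; exists (size s'); apply: (sorted_eq leq_trans anti_leq so) => //.
    rewrite /= path_min_sorted ?all_nseq ?N0 ?orbT //.
    by elim: (size s') => // -[|k] //= ->; rewrite leqnn.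
  by rewrite -(all_eq_nseq sE) -d01.
right; rewrite (perm_big _ ps) big_cons (perm_big _ (perm_to_rem d1s)) big_cons /=.
have := dvdn_half N0 (sN _ d0s) d0N.
have d1s' : d1 \in s by apply: mem_rem d1s.
have := dvdn_half N0 (sN _ d1s') d1N.
by move: (\sum_(_ <- _) _)%N => S; lia.
Qed.

End Divisors.

(** * Dicritical vertices and nodes *)

Section Nodes.

Variable T : decorated_tree.
Hypothesis NT : newton_tree T.
Hypothesis MC : minimally_complete T.
Implicit Types x y v w u b : T.

Lemma dic_dead u : u \in dicriticals T -> exists2 b, b \in arrows0 T & b \in ch u.
Proof.
move=> ud; have [e de ue] := mc_dicritical MC ud.
by have [b [b0 bu _]] := dead_endP (dic_vertex ud) de ue; exists b.
Qed.

Lemma degE u : u \in dicriticals T -> deg u = #|[set x in ch u | x \in arrows1 T]|.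
Proof.
move=> ud; apply: eq_card => x; rewrite [LHS]inE [RHS]inE andbC.
case x1: (x \in arrows1 T); rewrite ?andbF // !andbT; apply/idP/idP; last exact: ch_adj.
exact: arrow_adj (arrows1_arrow x1).
Qed.

Lemma Yup_dic u : u \in dicriticals T -> Yup u = a_ u * (deg u)%:Z.
Proof.
move=> ud; have [b b0 bu] := dic_dead ud.
rewrite Yup_ch ?vertex_arrows1 ?dic_vertex // (bigID (mem (arrows1 T))) /=.
rewrite [X in _ + X]big1 ?addr0; last first.
  move=> x /andP[xu x1]; rewrite Yup_arrow0 ?mulr0 //.
  by move: x1; rewrite inE negb_and negbK (dic_ch NT MC ud xu) orbF.
rewrite (eq_bigr (fun=> a_ u)) => [|x /andP[xu x1]]; last first.
  rewrite Yup_arrow1 // mulr1 (Qsib_dead NT b0 bu) //.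
  by apply: contraTneq x1 => ->; apply: arrows01.
rewrite (eq_bigl (mem [set x in ch u | x \in arrows1 T])) => [|x]; last by rewrite !inE.
by rewrite sumr_const -degE // -mulr_natr natz.
Qed.

Lemma deg_gt0 u : u \in dicriticals T -> (0 < deg u)%N.
Proof.
move=> ud; have := Yup_vertex NT (dic_vertex ud); rewrite Yup_dic //.
by case: (deg u) => //; rewrite mulr0.
Qed.

Lemma deg_le_Yup u : u \in dicriticals T -> (deg u)%:Z <= Yup u.
Proof. by move=> ud; rewrite Yup_dic //; have := a_ge1 NT (dic_vertex ud); nia. Qed.

(** Here [mult u = 0] and [Yup u = Qup u * deg u], so [Qup u] cancels out of
    [mult_edge]. *)
Lemma mult_dic v u : v \in vertices T -> u \in dic_at v ->
  mult v = - det v u * (deg u)%:Z.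
Proof.
move=> vv uv; have ud := dic_at_dic uv; have uc := dic_at_ch NT MC vv uv.
have := mult_edge uc; rewrite (dic_mult ud) mulr0 Yup_dic //.
have [b b0 bu] := dic_dead ud; rewrite (Qup_dead NT b0 bu).
have := a_ge1 NT (dic_vertex ud); move: (a_ u) => a a1.
move=> e; have a0 : a != 0 by lia.
apply: (mulfI a0); apply/eqP; rewrite -subr_eq0. rewrite [X in _ == X]e; apply/eqP; ring.
Qed.

Lemma deg_dvd v u : v \in vertices T -> u \in dic_at v -> (deg u %| `|mult v|)%N.
Proof. by move=> vv /(mult_dic vv)->; rewrite abszM dvdn_mull. Qed.

Lemma deg_le v u : v \in calN T -> u \in dic_at v -> (deg u <= `|mult v|)%N.
Proof.
move=> vN uv; apply: dvdn_leq (deg_dvd (calN_vertex vN) uv).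
by have := calN_gt0 vN; lia.
Qed.

Lemma slack_ge0 v : v \in calN T -> 0 <= slack v.
Proof.
move=> vN; apply: sumr_ge0 => u uv; have := deg_le vN uv; have := calN_gt0 vN.
by lia.
Qed.

Definition sigma v : int := \sum_(u in dic_at v) (deg u)%:Z.

Lemma slackE v : slack v = #|dic_at v|%:Z * mult v - sigma v.
Proof. by rewrite /slack sumrB sumr_const -mulr_natl natz. Qed.

Lemma big_node_type (R : Type) (idx : R) (op : Monoid.com_law idx) (F : nat -> R) v :
  \big[op/idx]_(d <- node_type v) F d = \big[op/idx]_(u in dic_at v) F (deg u).
Proof.
by rewrite (perm_big _ (permEl (perm_sort _ _))) big_map big_enum.
Qed.

Lemma size_node_type v : size (node_type v) = #|dic_at v|.
Proof. by rewrite size_sort size_map -cardE. Qed.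

Lemma sigma_node_type v : sigma v = (sumn (node_type v))%:Z.
Proof.
rewrite sumnE big_node_type /sigma; elim/big_rec2: _ => // u m n _ ->.
by rewrite PoszD.
Qed.

Definition type1 v := exists k, node_type v = 1%N :: nseq k `|mult v|%N.

Lemma type1_type_one_mult v : v \in calN T -> type1 v -> type_one_mult v.
Proof.
move=> vN [k e]; exists k; rewrite e /= map_nseq gez0_abs //.
by have := calN_gt0 vN; lia.
Qed.

Lemma node_dichotomy v : v \in nodes T -> nodes T = nodes_star T ->
  type1 v /\ slack v = mult v - 1 \/ mult v <= slack v.
Proof.
move=> vn nn; have vs : v \in nodes_star T by rewrite -nn.
have vN : v \in calN T by move: vn; rewrite inE => /andP[].
have vv := calN_vertex vN; have N0 := calN_gt0 vN.
have sE : slack v = (\sum_(d <- node_type v) (`|mult v| - d))%N%:Z.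
  rewrite big_node_type /slack.
  rewrite (eq_bigr (fun u => (`|mult v| - deg u)%N%:Z)) => [|u uv].
    by elim/big_rec2: _ => // u m n _ ->; rewrite PoszD.
  by have := deg_le vN uv; lia.
have := @gcd1_slack `|mult v|%N (node_type v); case.
- by lia.
- by rewrite -size_eq0 size_node_type cards_eq0; move: vn; rewrite inE => /andP[].
- apply/allP => d; rewrite mem_sort => /mapP[u]; rewrite mem_enum => uv ->.
  exact: deg_dvd.
- by move: vs; rewrite inE => /andP[_ /eqP].
- by apply: sort_sorted; apply: leq_total.
- case=> k e; left; split; first by exists k.
  rewrite sE e big_cons big_nseq subnn iter_addn_0 mul0n addn0; lia.
by move=> h; right; rewrite sE; lia.
Qed.

Lemma sum_Yup_ch v : v \in calN T ->
  \sum_(x in ch v) Yup x = \sum_(x in cN v) Yup x + \sum_(u in dic_at v) Yup u.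
Proof.
move=> vN; have vv := calN_vertex vN.
rewrite (bigID (mem (calN T))) /=; congr (_ + _).
  by apply: eq_bigl => x; rewrite [RHS]inE.
rewrite (bigID (mem (dicriticals T))) /= [X in _ + X]big1 ?addr0.
  apply: eq_bigl => x; rewrite (dic_atE NT MC) // [RHS]inE.
  case xd: (x \in dicriticals T); rewrite ?andbF // !andbT.
  by case xN: (x \in calN T); rewrite ?andbT //; have := calN_ndic MC xN; rewrite xd.
move=> x /andP[/andP[xv xN] xd]; apply: Yup_arrow0.
have := ch_cases NT MC vN xv; rewrite [x \in cN v]inE (negPf xN) andbF /=.
by rewrite [x \in dic_at v]inE (negPf xd).
Qed.

Lemma sigma_le v : sigma v <= \sum_(u in dic_at v) Yup u.
Proof. by apply: ler_sum => u /dic_at_dic; apply: deg_le_Yup. Qed.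

Lemma Yup_ge_sigma v : v \in calN T ->
  a_ v * (\sum_(x in cN v) Yup x + sigma v) <= Yup v.
Proof.
move=> vN; apply: le_trans (Yup_ge_a NT (calN_vertex vN)).
rewrite sum_Yup_ch //; have := sigma_le v; have := a_ge1 NT (calN_vertex vN).
by move: (\sum_(_ in cN v) _) (\sum_(_ in _) _) => A B; nia.
Qed.

Lemma Yup_v0 : Yup (v0 T) = \sum_(x in ch (v0 T)) Yup x.
Proof.
rewrite Yup_ch ?vertex_arrows1 ?v0_vertex //; apply: eq_bigr => x xv.
by rewrite [Qsib _ _]big1 ?mul1r // => y /andP[yv _]; apply: qq_v0.
Qed.

Lemma Yup_dead v b : b \in arrows0 T -> b \in ch v ->
  Yup v = a_ v * \sum_(x in ch v) Yup x.
Proof.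
move=> b0 bv; rewrite Yup_ch ?vertex_arrows1 ?(ch_vertex bv) // mulr_sumr.
apply: eq_bigr => x xv; have [->|xb] := eqVneq x b; first by rewrite Yup_arrow0 ?mulr0.
by rewrite (Qsib_dead NT b0 bv xv xb).
Qed.

(** The vertices of positive multiplicity form a subtree containing the root. *)
Lemma calN_closed (A : {set T}) : v0 T \in A ->
  (forall v x, v \in A -> x \in cN v -> x \in A) -> calN T \subset A.
Proof.
move=> A0 Ach; apply/subsetP; elim/tree_ind => // v x IH xv xN.
have vN : v \in calN T by rewrite -(par_ch xv) (par_calN NT MC) // (ch_neq_v0 xv).
by apply: Ach (IH vN) _; rewrite inE xv xN.
Qed.

End Nodes.

(** * Rational trees *)

Section Rational.

Variable T : decorated_tree.
Hypothesis RT : rational_tree T.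
Hypothesis nodes_eq : nodes T = nodes_star T.
Implicit Types x y v w u b : T.

Let NT : newton_tree T := rational_newton RT.
Let MC : minimally_complete T := rational_complete RT.

Lemma node_in v : v \in calN T -> dic_at v != set0 -> v \in nodes T.
Proof. by move=> vN dv; rewrite inE vN. Qed.

Lemma slack_ge v : v \in calN T -> dic_at v != set0 -> mult v - 1 <= slack v.
Proof.
by move=> vN dv; case: (node_dichotomy NT MC (node_in vN dv) nodes_eq) => [[_ ->]|]; lia.
Qed.

Lemma slack_no_dic v : dic_at v = set0 -> slack v = 0.
Proof. by move=> dv; rewrite /slack dv big_set0. Qed.

Lemma mult_ratio v : v \in calN T -> let n := (mult v)%:~R : rat in
  [/\ 1 <= n, 0 < n / (a_ v)%:~R <= n &
      2 <= a_ v -> n / (a_ v)%:~R <= n / 2].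
Proof.
move=> vN n; have n1 : 1 <= n by rewrite /n ler1z; have := calN_gt0 vN; lia.
have a1 : 1 <= (a_ v)%:~R :> rat by rewrite ler1z a_ge1 ?calN_vertex.
have a0 : 0 < (a_ v)%:~R :> rat by lra.
split=> //; first by rewrite divr_gt0 ?ler_pdivrMr //=; nra.
move=> a2; have a2' : 2 <= (a_ v)%:~R :> rat by rewrite (ler_int _ 2).
by rewrite ler_pdivrMr //; nra.
Qed.

Lemma no_branch_node v : v \in calN T -> v != v0 T -> cN v = set0 ->
  dic_at v != set0 /\ (a_ v = 1 -> (2 <= #|dic_at v|)%N).
Proof.
move=> vN vn c0; have := ch_card_ge2 MC (calN_vertex vN) vn.
rewrite (ch_card NT MC vN) c0 cards0 add0n -card_gt0.
by case: eqP => [->|] /=; rewrite ?addn0; [|]; case: #|_| => [|[|k]].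
Qed.

(** A leaf other than the root is a node, because of the condition on
    valencies; its slack makes up for the missing branch. *)
Lemma Delta_lower v : v \in calN T -> v != v0 T ->
  (mult v)%:~R - (mult v)%:~R / (a_ v)%:~R <= Delta v.
Proof.
move=> vN vn; rewrite (DeltaE_ch NT MC vN vn); have [n1 _ _] := mult_ratio vN.
have [c0|/set0Pn[w wc]] := eqVneq (cN v) set0.
  have [dv _] := no_branch_node vN vn c0; have := slack_ge vN dv.
  by rewrite c0 cards0 -(ler_int rat) rmorphB /=; lra.
have c1 : 1 <= #|cN v|%:R :> rat.
  by rewrite ler1n card_gt0; apply/set0Pn; exists w.
have := slack_ge0 NT MC vN; rewrite -(ler_int rat) /=; nra.
Qed.

Lemma Delta_ge0 v : v \in calN T -> v != v0 T -> 0 <= Delta v.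
Proof.
move=> vN vn; apply: le_trans (Delta_lower vN vn).
by have [_ /andP[_ h] _] := mult_ratio vN; lra.
Qed.

(** When [Delta v = 0] there is no dead end at [v]. With a branch of [calN T]
    above [v], the valency of [v] then requires a second branch or a node, and
    either makes [Delta v] positive because [mult v >= 2]. *)
Lemma Delta_eq0 v : v \in calN T -> v != v0 T -> Delta v = 0 ->
  [/\ cN v = set0, a_ v = 1, type1 v & (2 <= #|dic_at v|)%N].
Proof.
move=> vN vn D0; have := Delta_lower vN vn; rewrite D0.
have [n1 _ n2] := mult_ratio vN => n3.
have a1 : a_ v = 1.
  have a1 := a_ge1 NT (calN_vertex vN); have [/n2 h|] := leP 2 (a_ v); last by lia.
  by exfalso; lra.
move: D0; rewrite (DeltaE_ch NT MC vN vn) a1 divr1.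
have [c0|/set0Pn[w wc]] := eqVneq (cN v) set0.
  have [dv /(_ a1) d2] := no_branch_node vN vn c0; rewrite c0 cards0 => D0.
  split=> //; case: (node_dichotomy NT MC (node_in vN dv) nodes_eq) => [[//]|].
  by rewrite -(ler_int rat) => h; lra.
have := mult_ge2 NT MC wc; rewrite -(ler_int rat) /= => N2 D0.
have c1 : (1 <= #|cN v|)%N by rewrite card_gt0; apply/set0Pn; exists w.
have s0 : 0 <= (slack v)%:~R :> rat by rewrite ler0z slack_ge0.
have c2 : ~ (2 <= #|cN v|)%N.
  by rewrite -(ler_nat rat) => h; nra.
have := ch_card_ge2 MC (calN_vertex vN) vn.
rewrite (ch_card NT MC vN) a1 eqxx addn0 => ch2.
have dv : dic_at v != set0 by rewrite -card_gt0; lia.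
have := slack_ge vN dv; rewrite -(ler_int rat) rmorphB /= => s1.
have e : #|cN v| = 1%N by lia.
by rewrite e in D0; lra.
Qed.

Lemma Delta_v0 : Delta (v0 T) =
  (#|cN (v0 T)|%:R - 2) * ((mult (v0 T))%:~R - 1) + (slack (v0 T))%:~R.
Proof.
have vN := v0_calN NT; rewrite (DeltaE MC vN) (epsilonE NT MC vN) eqxx addn0.
by rewrite (a_v0 NT MC); field.
Qed.

Lemma Delta_sum : \sum_(v in calN T) Delta v = 0.
Proof. exact: rational_Delta RT. Qed.

Lemma cN_neq_v0 v x : x \in cN v -> x != v0 T.
Proof. by move/cN_ch/ch_neq_v0. Qed.

Lemma cN_par v x : x \in cN v -> par x = v.
Proof. by move/cN_ch/par_ch. Qed.

Lemma epsilon_v0 : epsilon (v0 T) = #|cN (v0 T)|.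
Proof. by rewrite (epsilonE NT MC (v0_calN NT)) eqxx addn0. Qed.

Lemma epsilon_leaf v : v \in calN T -> v != v0 T -> cN v = set0 -> epsilon v = 1%N.
Proof. by move=> vN vn c0; rewrite (epsilonE NT MC vN) vn c0 cards0. Qed.

Lemma sigma_type1 v k : node_type v = 1%N :: nseq k `|mult v|%N ->
  sigma v = 1 + `|mult v|%N%:Z * k%:Z.
Proof. by move=> e; rewrite sigma_node_type e /= sumn_nseq PoszD PoszM. Qed.

Lemma dic_at_card_sigma v : v \in calN T -> #|dic_at v|%:Z <= sigma v.
Proof.
move=> vN; rewrite -[#|_|%:Z]natz -sumr_const /sigma.
by apply: ler_sum => u /dic_at_dic ud; have := deg_gt0 NT MC ud; lia.
Qed.

End Rational.

(** * The root is the only vertex of positive multiplicity *)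

Section Elementary.

Variable T : decorated_tree.
Hypothesis RT : rational_tree T.
Hypothesis nodes_eq : nodes T = nodes_star T.
Implicit Types x y v w u b : T.

Let NT : newton_tree T := rational_newton RT.
Let MC : minimally_complete T := rational_complete RT.

Lemma edges_ch (P : {set T} -> Prop) :
  (forall v x, x \in ch v -> P [set v; x]) -> forall e, e \in edges T -> P e.
Proof.
move=> Pch e eE; have /eqP/cards2P[x [y [_ exy]]] := edges_card2 eE.
have xy : adj x y by rewrite /adj /edge_rel -exy.
rewrite exy; move: xy; rewrite adjE => /orP[/Pch//|/andP[xn /eqP->]].
by rewrite setUC; apply/Pch/ch_par.
Qed.

Lemma ch_edge v x : x \in ch v -> [set v; x] \in edges T.
Proof. exact: ch_adj. Qed.

Lemma dic_deg1 u : u \in dicriticals T -> deg u = 1%N -> exists al be,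
  [/\ al \in arrows1 T, be \in arrows0 T, al != be & ch u = [set al; be]].
Proof.
move=> ud; rewrite degE // => /eqP/cards1P[al e].
have [be b0 bu] := dic_dead MC ud.
have : al \in [set x in ch u | x \in arrows1 T] by rewrite e inE.
rewrite inE => /andP[alu al1]; exists al, be; split=> //.
  by apply: contraTneq al1 => ->; apply: arrows01.
apply/setP=> x; rewrite !in_set2; apply/idP/orP => [xu|[]/eqP->//].
case x0: (x \in arrows0 T); first by right; rewrite (arrows0_uniq NT (x0 : x \in arrows0 T) xu b0 bu).
have : x \in [set x in ch u | x \in arrows1 T].
  by rewrite inE xu inE x0 (dic_ch NT MC ud xu).
by rewrite e inE; left.
Qed.

Lemma one_arrow1 al : al \in arrows1 T -> one_arrow al.
Proof. by rewrite inE => /andP[h1 h2]; move: h1; rewrite inE h2 /= negbK. Qed.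

Lemma one_arrow0 be : be \in arrows0 T -> ~~ one_arrow be.
Proof. by rewrite inE => /andP[]. Qed.

Hypothesis c0 : cN (v0 T) = set0.

Let n := mult (v0 T).

Lemma calN_v0 : calN T = [set v0 T].
Proof.
apply/eqP; rewrite eqEsubset sub1set v0_calN // andbT.
apply: (calN_closed NT MC); first exact: set11.
by move=> v x /set1P->; rewrite c0 in_set0.
Qed.

Lemma ch_v0_dic : ch (v0 T) = dic_at (v0 T).
Proof.
apply/setP=> x; apply/idP/idP => [xv|]; last exact: (dic_at_ch NT MC (v0_vertex T)).
by have := ch_cases NT MC (v0_calN NT) xv; rewrite c0 inE (negPf (dead_v0 NT MC xv)) orbF.
Qed.

Lemma elementary_mult : n = \sum_(u in dic_at (v0 T)) Yup u.
Proof. by rewrite /n mult_v0 Yup_v0 // ch_v0_dic. Qed.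

(** With [k] dicriticals at the root and [s] the sum of their degrees, the
    vanishing of [Delta] reads [k n - s = 2 (n - 1)], while [s <= n]. *)
Lemma elementary_degrees :
  (exists u, [/\ dic_at (v0 T) = [set u], deg u = 1%N & n = 1]) \/
  (exists u1 u2, [/\ u1 != u2, dic_at (v0 T) = [set u1; u2], deg u1 = 1%N
     & deg u2 = 1%N]).
Proof.
have vN := v0_calN NT; have n0 : 0 < n := calN_gt0 vN.
have sn : sigma (v0 T) <= n by rewrite elementary_mult; apply: sigma_le.
have sD := dic_at_card_sigma RT vN.
have D0 : dic_at (v0 T) != set0.
  have [x xv _] := ch_one_above NT (v0_vertex T).
  by apply/set0Pn; exists x; rewrite -ch_v0_dic.
have k0 : (0 < #|dic_at (v0 T)|)%N by rewrite card_gt0.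
have s2 : slack (v0 T) = n *+ 2 - 2.
  apply/eqP; rewrite -(eqr_int rat); have := Delta_sum RT.
  rewrite calN_v0 big_set1 (Delta_v0 RT) // c0 cards0 -/n rmorphB /= rmorphMn /=.
  by rewrite mulr2n => h; apply/eqP; lra.
have sE := slackE (v0 T); rewrite s2 -/n in sE.
have [k1|k2] : #|dic_at (v0 T)| = 1%N \/ #|dic_at (v0 T)| = 2%N.
  have : (#|dic_at (v0 T)| <= 2)%N by rewrite leqNgt; apply/negP => h; nia.
  by move: k0; lia.
- left; have /eqP/cards1P[u Du] := k1; exists u; split=> //.
    by move: sE sn sD; rewrite k1 /sigma Du !big_set1; lia.
  by move: sE sn sD; rewrite k1; lia.
right; have /eqP/cards2P[u1 [u2 [u12 Du]]] := k2; exists u1, u2.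
have u1D : u1 \in dic_at (v0 T) by rewrite Du set21.
have u2D : u2 \in dic_at (v0 T) by rewrite Du set22.
have d1 := deg_gt0 NT MC (dic_at_dic u1D); have d2 := deg_gt0 NT MC (dic_at_dic u2D).
have : sigma (v0 T) = (deg u1)%:Z + (deg u2)%:Z.
  by rewrite /sigma Du big_setU1 ?big_set1 // inE.
by split=> //; lia.
Qed.

Lemma all_cells x : [|| x == v0 T, x \in dic_at (v0 T) |
  [exists u, (u \in dic_at (v0 T)) && (x \in ch u)]].
Proof.
elim/tree_ind: x => [|v x]; first by rewrite eqxx.
case/or3P=> [/eqP->|vD|/existsP[u /andP[uD vu]]] xv.
- by rewrite -ch_v0_dic xv orbT.
- by apply/or3P; apply: Or33; apply/existsP; exists v; rewrite vD.
by have := arrow_ch x (dic_ch NT MC (dic_at_dic uD) vu); rewrite xv.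
Qed.

Lemma q_arrow v x : x \in arrows T -> x \in ch v -> q [set v; x] x = 1.
Proof.
by move=> xa xv; apply: (newton_q_arrow NT xa (ch_edge xv)); apply: set22.
Qed.

Lemma q_dic u : u \in dic_at (v0 T) -> deg u = 1%N -> q [set v0 T; u] u = a_ u - n.
Proof.
move=> uD d1; have := mult_dic NT MC (v0_vertex T) uD; rewrite d1 mulr1 -/n.
have uc : u \in ch (v0 T) by rewrite ch_v0_dic.
have [b b0 bu] := dic_dead MC (dic_at_dic uD).
rewrite detE (Qn_ch uc) (Qup_dead NT b0 bu) [Qn _ _]big1; last first.
  by move=> x /andP[vx _]; apply: qq_v0 => //; rewrite ch_v0 inE.
by rewrite qq_v0 // !mul1r /qq setUC => ->; ring.
Qed.

Lemma dic_struct u : u \in dic_at (v0 T) -> deg u = 1%N -> exists al be,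
  [/\ ch u = [set al; be], one_arrow al && ~~ one_arrow be,
      [&& al != be, al \in arrows T & be \in arrows T],
      [/\ q [set u; al] u = 1, q [set u; al] al = 1, q [set u; be] be = 1
        & q [set u; be] u = a_ u]
    & [/\ coprimez (q [set u; be] u) (q [set v0 T; u] u), par al = u & par be = u]].
Proof.
move=> uD d1; have ud := dic_at_dic uD.
have [al [be [al1 be0 ab chu]]] := dic_deg1 ud d1.
have alu : al \in ch u by rewrite chu set21.
have beu : be \in ch u by rewrite chu set22.
have ala := arrows1_arrow al1; have bea := arrows0_arrow be0.
exists al, be; rewrite (one_arrow1 al1) (one_arrow0 be0) ab ala bea (par_ch alu) (par_ch beu).
split=> //; split=> //.
- exact: (qq_dead1 NT be0 beu alu ab).
- exact: q_arrow.
- exact: q_arrow.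
- by rewrite (a_dead NT be0 beu).
have uc : u \in ch (v0 T) by rewrite ch_v0_dic.
apply: (newton_coprime NT (dic_vertex ud)); rewrite ?set21 ?set22 ?ch_edge //.
rewrite [[set v0 T; u]]setUC set2_eqr; apply: contraTneq bea => ->.
by rewrite !inE eqxx.
Qed.

Lemma elementary : elementary1 T \/ elementary2 T.
Proof.
have v0N x : x \in arrows T -> v0 T != x.
  by apply: contraTneq => <-; rewrite !inE eqxx.
have uN u x : u \in dic_at (v0 T) -> x \in arrows T -> u != x.
  move=> /dic_at_dic/dic_vertex; rewrite vertexN => h xa; by apply: contraNneq h => ->.
have vu u : u \in dic_at (v0 T) -> v0 T != u.
  by move=> /dic_at_dic/(dic_neq_v0 NT MC); rewrite eq_sym.
have q0 u : u \in dic_at (v0 T) -> q [set v0 T; u] (v0 T) = 1.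
  by rewrite -ch_v0_dic => /(qq_v0 NT).
case: elementary_degrees => [[u [Du d1 n1]]|[u1 [u2 [u12 Du d1 d2]]]]; [left|right].
  have uD : u \in dic_at (v0 T) by rewrite Du set11.
  have [al [be [chu oab /and3P[ab ala bea] [qua qa qb qub] _]]] := dic_struct uD d1.
  have au : a_ u = 1.
    have := elementary_mult; rewrite n1 Du big_set1 (Yup_dic NT MC (dic_at_dic uD)) d1.
    by lia.
  exists u, al, be; split=> //.
  - by rewrite /= !inE !negb_or (vu _ uD) !(v0N _ ala, v0N _ bea, uN _ _ uD ala, uN _ _ uD bea) ab.
  - apply/setP=> x; rewrite in_setT; have := all_cells x; rewrite Du !inE => /or3P[->|->|].
    + by [].
    + by rewrite orbT.
    by case/existsP=> y /andP[/set1P->]; rewrite chu !inE => /orP[]->; rewrite !orbT.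
  - apply/setP=> e; apply/idP/idP.
      move: e; apply: edges_ch => v x xv.
      have := all_cells v; rewrite Du inE => /or3P[/eqP e|/eqP e|].
      * move: xv; rewrite e ch_v0_dic Du => /set1P->; by rewrite !inE eqxx.
      * by move: xv; rewrite e chu => /set2P[]->; rewrite !inE eqxx ?orbT.
      case/existsP=> y /andP[/set1P->]; rewrite chu => /set2P[]e; move: xv; rewrite e.
        by rewrite (negPf (arrow_ch x ala)).
      by rewrite (negPf (arrow_ch x bea)).
    rewrite !inE => /orP[/orP[]|] /eqP->; apply: ch_edge; rewrite ?ch_v0_dic ?chu ?set21 ?set22 //.
  split; first by rewrite q_dic // au n1 subrr.
  move=> e x eE; move: eE x; move: e; apply: edges_ch => v y yv x.
  have := all_cells v; rewrite Du inE => /or3P[/eqP e|/eqP e|].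
  + move: yv; rewrite e ch_v0_dic Du => /set1P-> /set2P[]->; first by rewrite q0.
    by rewrite eqxx.
  + by move: yv; rewrite e chu => /set2P[]-> /set2P[]-> // _; rewrite qub au.
  case/existsP=> z /andP[/set1P->]; rewrite chu => /set2P[]e; move: yv; rewrite e.
    by rewrite (negPf (arrow_ch y ala)).
  by rewrite (negPf (arrow_ch y bea)).
have u1D : u1 \in dic_at (v0 T) by rewrite Du set21.
have u2D : u2 \in dic_at (v0 T) by rewrite Du set22.
have [al1 [be1 [chu1 /andP[oa1 ob1] /and3P[ab1 ala1 bea1] [qua1 qa1 qb1 qub1] [co1 pa1 pb1]]]] :=
  dic_struct u1D d1.
have [al2 [be2 [chu2 /andP[oa2 ob2] /and3P[ab2 ala2 bea2] [qua2 qa2 qb2 qub2] [co2 pa2 pb2]]]] :=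
  dic_struct u2D d2.
have a1 := a_ge1 NT (dic_vertex (dic_at_dic u1D)).
have a2 := a_ge1 NT (dic_vertex (dic_at_dic u2D)).
have nE : n = a_ u1 + a_ u2.
  rewrite elementary_mult Du big_setU1 ?inE // big_set1.
  by rewrite (Yup_dic NT MC (dic_at_dic u1D)) (Yup_dic NT MC (dic_at_dic u2D)) d1 d2 !mulr1.
have qv1 : q [set v0 T; u1] u1 = - a_ u2 by rewrite (q_dic u1D d1) nE opprD addrA subrr add0r.
have qv2 : q [set v0 T; u2] u2 = - a_ u1 by rewrite (q_dic u2D d2) nE [_ + a_ u2]addrC opprD addrA subrr add0r.
have parN x y : par x = u1 -> par y = u2 -> x != y.
  by move=> px py; apply: contraNneq u12 => xy; rewrite -px -py xy.
have chcase v x : x \in ch v -> 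
  [\/ v = v0 T /\ (x = u1 \/ x = u2), v = u1 /\ (x = al1 \/ x = be1) |
      v = u2 /\ (x = al2 \/ x = be2)].
  move=> xv; have := all_cells v; rewrite Du => /or3P[/eqP e|/set2P[]e|].
  - by apply: Or31; split=> //; move: xv; rewrite e ch_v0_dic Du => /set2P.
  - by apply: Or32; split=> //; move: xv; rewrite e chu1 => /set2P.
  - by apply: Or33; split=> //; move: xv; rewrite e chu2 => /set2P.
  case/existsP=> y /andP[/set2P[]->]; rewrite ?chu1 ?chu2 => /set2P[]e; exfalso; move: xv; rewrite e.
  - by rewrite (negPf (arrow_ch x ala1)).
  - by rewrite (negPf (arrow_ch x bea1)).
  - by rewrite (negPf (arrow_ch x ala2)).
  - by rewrite (negPf (arrow_ch x bea2)).
exists `|a_ u1|%N, `|a_ u2|%N, u1, u2, al1, al2, be1, be2; split; split.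
- rewrite !absz_gt0 !gt_eqF ?(lt_le_trans ltr01) //=.
  by move: co1; rewrite qub1 qv1 /coprimez gcdzN /gcdz.
- rewrite /= !inE !negb_or (vu _ u1D) (vu _ u2D).
  rewrite !(v0N _ ala1, v0N _ bea1, v0N _ ala2, v0N _ bea2).
  rewrite !(uN _ _ u1D ala1, uN _ _ u1D bea1, uN _ _ u1D ala2, uN _ _ u1D bea2).
  rewrite !(uN _ _ u2D ala1, uN _ _ u2D bea1, uN _ _ u2D ala2, uN _ _ u2D bea2).
  rewrite u12 ab1 ab2 [al2 == be1]eq_sym.
  by rewrite !(parN _ _ pa1 pa2, parN _ _ pa1 pb2, parN _ _ pb1 pa2, parN _ _ pb1 pb2).
- apply/setP=> x; rewrite in_setT !inE; have := all_cells x; rewrite Du => /or3P[->|/set2P[]->|].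
  + by [].
  + by rewrite eqxx !orbT.
  + by rewrite eqxx !orbT.
  by case/existsP=> y /andP[/set2P[]->]; rewrite ?chu1 ?chu2 => /set2P[]->; rewrite eqxx !orbT.
- apply/setP=> e; apply/idP/idP.
    move: e; apply: edges_ch => v x /chcase.
    by case=> -[-> [->|->]]; rewrite !(in_setU, in_set1) eqxx ?orbT.
  by case/setUP=> [/setUP[/setUP[/setUP[/setUP[]|]|]|]|] /set1P->; apply: ch_edge;
    rewrite ?ch_v0_dic ?chu1 ?chu2 ?set21 ?set22.
- by rewrite oa1 oa2 ob1 ob2.
- by rewrite qub1 qub2 !gez0_abs // (le_trans ler01).
- by rewrite qv1 qv2 !gez0_abs // (le_trans ler01).
move=> e x eE; move: eE x; move: e; apply: edges_ch => v y yv x.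
by case: (chcase _ _ yv) => -[-> [->|->]] /set2P[]->; rewrite ?q0 // !in_cons eqxx ?orbT.
Qed.

Lemma elementary_Omega : Omega T = set0.
Proof.
apply/setP=> x; rewrite in_set0 in_setD; apply/negbTE/negP => /andP[_].
rewrite inE calN_v0 => /andP[/set1P-> /andP[]].
by rewrite (epsilon_v0 RT) c0 cards0.
Qed.

End Elementary.

(** * All vertices have nonnegative [Delta] *)

Section NonNegative.

Variable T : decorated_tree.
Hypothesis RT : rational_tree T.
Hypothesis nodes_eq : nodes T = nodes_star T.
Implicit Types x y v w u b : T.

Let NT : newton_tree T := rational_newton RT.
Let MC : minimally_complete T := rational_complete RT.

Hypothesis c_neq0 : cN (v0 T) != set0.
Hypothesis root_node : #|cN (v0 T)| = 1%N -> dic_at (v0 T) != set0.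

Local Notation n := (mult (v0 T)).

Lemma root_mult_ge2 : 2 <= n.
Proof. by have /set0Pn[w /(mult_ge2 NT MC)] := c_neq0. Qed.

Lemma root_mult_ge2_rat : 2 <= n%:~R :> rat.
Proof. by rewrite (ler_int _ 2) root_mult_ge2. Qed.

Lemma Delta_v0_ge0 : 0 <= Delta (v0 T).
Proof.
have n2 := root_mult_ge2_rat; rewrite (Delta_v0 RT).
have s0 : 0 <= (slack (v0 T))%:~R :> rat by rewrite ler0z slack_ge0 // v0_calN.
have c1 : (0 < #|cN (v0 T)|)%N by rewrite card_gt0.
have [c2|c2] := leqP 2 #|cN (v0 T)|.
  by move: c2; rewrite -(ler_nat rat) => c2; nra.
have e : #|cN (v0 T)| = 1%N by lia.
have := slack_ge RT nodes_eq (v0_calN NT) (root_node e).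
by rewrite -(ler_int rat) rmorphB e /=; lra.
Qed.

Lemma all_Delta0 v : v \in calN T -> Delta v = 0.
Proof.
move: v; apply: (psumr_eq0P _ (Delta_sum RT)) => v vN.
by have [->|vn] := eqVneq v (v0 T); [apply: Delta_v0_ge0|apply: Delta_ge0].
Qed.

Lemma calN_root : calN T = v0 T |: cN (v0 T).
Proof.
apply/eqP; rewrite eqEsubset subUset sub1set v0_calN //=; apply/andP; split.
  apply: (calN_closed NT MC); first exact: setU11.
  move=> v x /setU1P[->|vc]; first exact: setU1r.
  have [-> _ _ _] := Delta_eq0 RT nodes_eq (cN_calN vc) (cN_neq_v0 vc) (all_Delta0 (cN_calN vc)).
  by rewrite in_set0.
by apply/subsetP => x /cN_calN.
Qed.

Lemma leaf_facts y : y \in cN (v0 T) ->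
  [/\ epsilon y = 1%N, a_ y = 1, type1 y, (2 <= #|dic_at y|)%N & y \in nodes T].
Proof.
move=> yc; have yN := cN_calN yc; have yn := cN_neq_v0 yc.
have [c0 a1 t1 d2] := Delta_eq0 RT nodes_eq yN yn (all_Delta0 yN).
split=> //; first exact: epsilon_leaf.
by apply: node_in; rewrite // -card_gt0; lia.
Qed.

(** Here [Delta (v0 T) = 0] and [mult (v0 T) >= 2]. Two branches leave no room
    for slack. A single branch forces the type [1, N, ..., N], and an entry [N]
    would make [Yup (v0 T) = mult (v0 T)] too large. *)
Lemma root_shape :
  [/\ #|cN (v0 T)| = 1%N, type1 (v0 T), #|dic_at (v0 T)| = 1%N & v0 T \in nodes T] \/
  (#|cN (v0 T)| = 2%N /\ dic_at (v0 T) = set0).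
Proof.
have vN := v0_calN NT; have n2 := root_mult_ge2; have n2r := root_mult_ge2_rat.
have s0 : 0 <= (slack (v0 T))%:~R :> rat by rewrite ler0z slack_ge0 // v0_calN.
have := all_Delta0 vN; rewrite (Delta_v0 RT) => D0.
have c1 : (0 < #|cN (v0 T)|)%N by rewrite card_gt0.
have [c2|c2] := leqP 2 #|cN (v0 T)|; [right|left].
  have c3 : (#|cN (v0 T)| <= 2)%N.
    rewrite leqNgt; apply/negP; rewrite -(ler_nat rat 3) => c3.
    have : 0 <= (#|cN (v0 T)|%:R - 3) * (n%:~R - 1) :> rat by apply: mulr_ge0; lra.
    by nra.
  have e : #|cN (v0 T)| = 2%N by lia.
  split=> //; apply/eqP; apply: contraT => dv.
  have := slack_ge RT nodes_eq vN dv.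
  by rewrite -(ler_int rat) rmorphB /=; rewrite e in D0; lra.
have e : #|cN (v0 T)| = 1%N by lia.
have vn := node_in vN (root_node e); rewrite e in D0.
case: (node_dichotomy NT MC vn nodes_eq) => [[t1 _]|]; last first.
  move=> h; have : n%:~R <= (slack (v0 T))%:~R :> rat by rewrite ler_int.
  by lra.
split=> //; case: t1 => k tk; have := sigma_type1 tk.
have /eqP/cards1P[y cy] := e; have yc : y \in cN (v0 T) by rewrite cy set11.
have := Yup_ge_sigma NT MC vN; rewrite -mult_v0 (a_v0 NT MC) mul1r cy big_set1.
have := Yup_vertex NT (calN_vertex (cN_calN yc)).
rewrite -size_node_type tk /= size_nseq => Y1 h sE; have : `|n|%N%:Z * k%:Z < n by lia.
by case: k {tk sE} => // k; nia.
Qed.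

Lemma Omega_Zset : Omega T = Zset T.
Proof.
rewrite /Omega big1 ?setD0 // => w _; apply/setP=> v; rewrite in_set0 inE.
apply/negbTE/negP => /and4P[/and4P[/andP[_ /allP zN] _ _ _] _ + _].
rewrite /Delta_set big1 ?ltxx // => x; rewrite inE => /zN; exact: all_Delta0.
Qed.

Lemma ZsetE x : (x \in Zset T) = (x \in calN T) && (epsilon x == 1%N).
Proof. by rewrite inE; case xN: (x \in calN T); rewrite //= all_Delta0 // lexx andbT. Qed.

Lemma nonnegative_structure :
  #|Omega T| = 2%N /\
  exists z : seq T,
    let z1 := head (v0 T) z in
    let zn := last (v0 T) z in
    [/\ trivial_path z /\ calN T = [set x in z],
        size z = 2%N \/ size z = 3%N,
        size z = 3%N -> v0 T = nth (v0 T) z 1,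
        forall x, x \in z -> a_ x = 1
      & nodes T = [set z1; zn] /\
        forall v, v \in nodes T ->
          type_one_mult v /\ (size (node_type v) = 1%N <-> v = v0 T)].
Proof.
have vN := v0_calN NT; have av := a_v0 NT MC.
case: root_shape => [[c1 t1 d1 vnode]|[c2 D0]].
  have /eqP/cards1P[y cy] := c1; have yc : y \in cN (v0 T) by rewrite cy set11.
  have [ey ay ty dy ynode] := leaf_facts yc; have yn := cN_neq_v0 yc.
  have cE : calN T = [set v0 T; y] by rewrite calN_root cy.
  have ev : epsilon (v0 T) = 1%N by rewrite (epsilon_v0 RT).
  have ZE : Zset T = [set v0 T; y].
    apply/setP=> x; rewrite ZsetE -cE; case xN: (x \in calN T) => //=.
    by move: xN; rewrite cE => /set2P[]->; rewrite ?ev ?ey.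
  have nE : nodes T = [set v0 T; y].
    apply/setP=> x; apply/idP/idP => [|/set2P[]->//].
    by rewrite inE -cE => /andP[].
  split; first by rewrite Omega_Zset ZE cards2 eq_sym yn.
  exists [:: v0 T; y]; split=> /=; [|by left|by []| |].
  - split; last by rewrite cE; apply/setP=> x; rewrite !inE.
    rewrite /trivial_path /path_in_calN /= ev eqxx vN (cN_calN yc) inE eq_sym yn.
    rewrite -[edge_rel _ _ _]/(adj (v0 T) y) (ch_adj (cN_ch yc)) /=.
    by apply/forallP => -[[|[|i]] //].
  - by move=> x; rewrite !inE => /orP[]/eqP->.
  rewrite nE; split=> // v /set2P[]->.
    by split; [exact: type1_type_one_mult|rewrite size_node_type d1].
  split; first exact: type1_type_one_mult (cN_calN yc) ty.
  by rewrite size_node_type; split=> [e|e]; [rewrite e in dy|rewrite e eqxx in yn].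
have /eqP/cards2P[y1 [y2 [y12 cy]]] := c2.
have y1c : y1 \in cN (v0 T) by rewrite cy set21.
have y2c : y2 \in cN (v0 T) by rewrite cy set22.
have [ey1 ay1 ty1 dy1 y1node] := leaf_facts y1c; have yn1 := cN_neq_v0 y1c.
have [ey2 ay2 ty2 dy2 y2node] := leaf_facts y2c; have yn2 := cN_neq_v0 y2c.
have cE : calN T = v0 T |: [set y1; y2] by rewrite calN_root cy.
have ev : epsilon (v0 T) = 2%N by rewrite (epsilon_v0 RT).
have ZE : Zset T = [set y1; y2].
  apply/setP=> x; rewrite ZsetE cE; apply/andP/idP.
    by case=> /setU1P[->|//]; rewrite ev.
  by move=> xy; split; [apply/setU1P; right|case/set2P: xy => ->; rewrite ?ey1 ?ey2].
have nE : nodes T = [set y1; y2].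
  apply/setP=> x; apply/idP/idP => [|/set2P[]->//].
  by rewrite inE cE => /andP[/setU1P[->|//]]; rewrite D0 eqxx.
split; first by rewrite Omega_Zset ZE cards2 y12.
exists [:: y1; v0 T; y2]; split=> /=; [|by right|by []| |].
- split; last by rewrite cE; apply/setP=> x; rewrite !inE orbCA.
  rewrite /trivial_path /path_in_calN /= ey1 eqxx vN (cN_calN y1c) (cN_calN y2c) !inE.
  rewrite negb_or yn1 y12 eq_sym yn2.
  rewrite -[edge_rel _ _ y2]/(adj (v0 T) y2) (ch_adj (cN_ch y2c)) /=.
  rewrite -[edge_rel _ _ _]/(adj y1 (v0 T)) adjC (ch_adj (cN_ch y1c)) /=.
  by apply/forallP => -[[|[|[|i]]] //] _ /=; rewrite ev all_Delta0 ?eqxx.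
- by move=> x; rewrite !inE => /or3P[]/eqP->.
rewrite nE; split=> // v vy.
have [tv dv vn] : [/\ type_one_mult v, (2 <= #|dic_at v|)%N & v != v0 T].
  by case/set2P: vy => ->; split=> //; [apply: type1_type_one_mult ty1|apply: type1_type_one_mult ty2];
     apply: cN_calN; eassumption.
split=> //; rewrite size_node_type.
by split=> [e|e]; [rewrite e in dv|rewrite e eqxx in vn].
Qed.

End NonNegative.

(** * The root is a leaf without dicriticals *)

Section Comb.

Variable T : decorated_tree.
Hypothesis RT : rational_tree T.
Hypothesis nodes_eq : nodes T = nodes_star T.
Implicit Types x y v w u b : T.

Let NT : newton_tree T := rational_newton RT.
Let MC : minimally_complete T := rational_complete RT.

Lemma calN_gam v x : v \in calN T -> x \in gam (v0 T) v -> x \in calN T.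
Proof.
elim/tree_ind: v x => [|v w IH wv] x; first by move=> vN; rewrite gamxx mem_seq1 => /eqP->.
move=> wN; rewrite (ch_gam wv) mem_rcons inE => /orP[/eqP->//|]; apply: IH.
exact: calN_par wv (calN_vertex wN).
Qed.

Lemma gam_parE v : v != v0 T -> gam (v0 T) v = rcons (gam (v0 T) (par v)) v.
Proof. by move=> vn; apply/ch_gam/ch_par. Qed.

(** If all (1)-arrows are above the child [w] of [v], as expressed by the
    hypothesis, then [mult w] is a multiple of [Yup w]. *)
Lemma mult_all_above v w : w \in ch v -> mult v = Qn v w * Yup w ->
  mult w = qq w v * Yup w.
Proof.
move=> wv e; have q1 := qq_ge1 NT wv; have q0 : qq v w != 0 by lia.
by apply: (mulfI q0); rewrite (mult_edge wv) e detE (Qn_ch wv); ring.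
Qed.

Lemma node_type_gt0 v : all (leq 1) (node_type v).
Proof.
apply/allP => d; rewrite mem_sort => /mapP[u]; rewrite mem_enum => uv ->.
exact: deg_gt0 (dic_at_dic uv).
Qed.

Lemma multiple_cases (n q Y : int) : n = q * Y -> 0 < n -> 1 <= Y ->
  n = Y \/ Y *+ 2 <= n.
Proof.
rewrite mulr2n => e n0 Y1; have [q1|q1] := eqVneq q 1; first by left; rewrite e q1 mul1r.
by have q2 : 2 <= q by [nia]; right; nia.
Qed.

Lemma multiple_le (n q Y : int) : n = q * Y -> 0 < n -> 1 <= Y -> Y <= n.
Proof. by move=> e n0 Y1; case: (multiple_cases e n0 Y1) => [->|]; rewrite ?mulr2n; lia. Qed.

Lemma sigma_le_ratio v : v \in calN T -> cN v = set0 ->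
  a_ v * sigma v <= Yup v.
Proof.
by move=> vN c0; have := Yup_ge_sigma NT MC vN; rewrite c0 big_set0 add0r.
Qed.

Lemma type1_single v : v \in calN T -> type1 v -> sigma v < mult v + 1 ->
  node_type v = [:: 1%N].
Proof.
move=> vN [k tk]; have n0 := calN_gt0 vN.
by rewrite (sigma_type1 tk) tk; case: k {tk} => // k; nia.
Qed.

Lemma sigma_lt_Yup v w : v \in calN T -> w \in cN v -> sigma v < Yup v.
Proof.
move=> vN wc; have := Yup_ge_sigma NT MC vN; rewrite (bigD1 w) //=.
have := Yup_vertex NT (calN_vertex (cN_calN wc)); have := a_ge1 NT (calN_vertex vN).
have : 0 <= \sum_(x in cN v | x != w) Yup x by apply: sumr_ge0 => x _; apply: Yup_ge0.
have : 0 <= sigma v by apply: sumr_ge0.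
move: (\sum_(_ in _ | _) _) (sigma v) (Yup w) => A B C B0 A0 a1 C1.
have : A + B + C <= a_ v * (C + A + B) by nia.
by lia.
Qed.

Lemma single_dead v : v \in calN T -> v != v0 T -> #|cN v| = 1%N ->
  dic_at v = set0 -> 2 <= a_ v.
Proof.
move=> vN vn ce d0; have vv := calN_vertex vN.
have := ch_card_ge2 MC vv vn; rewrite (ch_card NT MC vN) ce d0 cards0.
by have := a_ge1 NT vv; case: eqP => //= an a1 _; lia.
Qed.

(** The last vertex of the chain when it is a leaf: [Delta v = Yup v - 1 < mult v]
    leaves no room for two proper divisors, except for two degrees 1. *)
Lemma leaf_end v q : v \in calN T -> v != v0 T -> cN v = set0 ->
  mult v = q * Yup v -> Delta v = (Yup v)%:~R - 1 ->
  [/\ 0 < Delta v, dic_at v != set0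
    & node_type v = [:: 1%N] \/ node_type v = [:: 1%N; 1%N]].
Proof.
move=> vN vn c0 nE DE; have n0 := calN_gt0 vN.
have Y1 := Yup_vertex NT (calN_vertex vN); have Yn := multiple_le nE n0 Y1.
have [dv d2] := no_branch_node RT vN vn c0.
have aS := sigma_le_ratio vN c0; have a1 := a_ge1 NT (calN_vertex vN).
have mS := dic_at_card_sigma RT vN.
have m0 : (0 < #|dic_at v|)%N by rewrite card_gt0.
suff [Y2 tE] : 2 <= Yup v /\ (node_type v = [:: 1%N] \/ node_type v = [:: 1%N; 1%N]).
  split=> //; have : 2 <= (Yup v)%:~R :> rat by rewrite (ler_int _ 2).
  by rewrite DE; lra.
case: (node_dichotomy NT MC (node_in vN dv) nodes_eq) => [[t1 _]|sn].
  have tk : node_type v = [:: 1%N] by apply: type1_single => //; nia.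
  split; last by left.
  have m1 : #|dic_at v| = 1%N by rewrite -size_node_type tk.
  have : a_ v != 1 by apply/eqP => /d2; rewrite m1.
  move=> a1'; have a2 : 2 <= a_ v by lia.
  by have := mS; rewrite m1; nia.
have [r1 /andP[_ r2] r3] := mult_ratio RT vN.
have D1 : 1 - (mult v)%:~R / (a_ v)%:~R + (slack v)%:~R = (Yup v)%:~R - 1 :> rat.
  by rewrite -DE (DeltaE_ch NT MC vN vn) c0 cards0; ring.
have sE := slackE v.
have m2 : (2 <= #|dic_at v|)%N.
  rewrite ltnNge; apply/negP => m1.
  have m1' : #|dic_at v| = 1%N by lia.
  by move: sn; rewrite sE m1' mul1r; lia.
have Ynr : (Yup v)%:~R <= (mult v)%:~R :> rat by rewrite ler_int.
have a1' : a_ v = 1.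
  have [a2|] := leP 2 (a_ v); last by lia.
  exfalso; have r4 := r3 a2.
  have a0r : 0 < (a_ v)%:~R :> rat by rewrite ltr0z; lia.
  have h : (sigma v)%:~R <= (mult v)%:~R / (a_ v)%:~R :> rat.
    by rewrite ler_pdivlMr // mulrC -intrM ler_int; lia.
  have : (2 * mult v - sigma v)%:~R <= (slack v)%:~R :> rat.
    by rewrite ler_int sE; nia.
  by rewrite rmorphB rmorphM /=; lra.
rewrite a1' divr1 in D1.
have sE2 : slack v = Yup v - 2 + mult v.
  by apply/eqP; rewrite -(eqr_int rat) rmorphD rmorphB /=; apply/eqP; lra.
rewrite a1' mul1r in aS.
have m3 : (#|dic_at v| <= 2)%N by rewrite leqNgt; apply/negP => m3; nia.
have m2' : #|dic_at v| = 2%N by lia.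
rewrite m2' in sE mS.
have s2 : sigma v = 2.
  by case: (multiple_cases nE n0 Y1) => [|]; rewrite ?mulr2n; lia.
split; first by lia.
right; have := node_type_gt0 v; have := sigma_node_type v; have := size_node_type v.
rewrite m2' s2; case: (node_type v) => [|d1 [|d2' [|]]] //= _ ds /and3P[d1p d2p _].
by congr [:: _; _]; lia.
Qed.

(** The shape of [calN T]: the path from the root to [zn], with at most two
    leaves above [zn]. *)
Definition comb zn : Prop :=
  [/\ zn \in calN T /\ zn != v0 T,
      calN T = [set x in gam (v0 T) zn] :|: cN zn,
      (forall x, x \in gam (v0 T) zn -> x != v0 T -> 0 < Delta x) /\
      (forall x, x \in gam (v0 T) zn -> x != zn -> dic_at x = set0),
      forall y, y \in cN zn -> Delta y = 0
    & [\/ [/\ cN zn = set0, dic_at zn != set0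
            & node_type zn = [:: 1%N] \/ node_type zn = [:: 1%N; 1%N]],
          #|cN zn| = 1%N /\ (dic_at zn = set0 \/ node_type zn = [:: 1%N])
        | #|cN zn| = 2%N /\ dic_at zn = set0]].

Lemma calN_top v : v \in calN T ->
  (forall x, x \in gam (v0 T) v -> x != v -> {subset cN x <= gam (v0 T) v}) ->
  (forall y, y \in cN v -> cN y = set0) ->
  calN T = [set x in gam (v0 T) v] :|: cN v.
Proof.
move=> vN sub leaves; apply/eqP; rewrite eqEsubset; apply/andP; split.
  apply: (calN_closed NT MC) => [|x y]; first by rewrite !inE mem_gam_l.
  case/setUP=> [|/leaves->]; last by rewrite in_set0.
  rewrite inE => xv yx; apply/setUP.
  have [xE|xn] := eqVneq x v; first by right; rewrite -xE.
  by left; rewrite inE; apply: sub xn _ yx.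
apply/subsetP => x /setUP[|/cN_calN//]; rewrite inE; exact: calN_gam.
Qed.

(** Going up from the root, let [v] be the next vertex. As long as [v] has a
    single successor and no dicritical, it carries a dead end with
    [mult v = Yup v], and the sum of [Delta] over the part of the tree above [v]
    is again [Yup w - 1] for the successor [w]. *)
Lemma chain v : v \in calN T -> v != v0 T ->
  (forall x, x \in gam (v0 T) (par v) -> dic_at x = set0) ->
  (forall x, x \in gam (v0 T) (par v) -> x != v0 T -> 0 < Delta x) ->
  (forall x, x \in gam (v0 T) (par v) -> {subset cN x <= gam (v0 T) v}) ->
  mult v = qq v (par v) * Yup v ->
  \sum_(x in calN T | x \notin gam (v0 T) v) Delta x = (Yup v)%:~R - 1 - Delta v ->
  exists zn, comb zn.
Proof.
elim/tree_down_ind: v => v IH vN vn dic0 Dpos cNsub nE DE.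
have gE := gam_parE vn; have n0 := calN_gt0 vN.
have vv := calN_vertex vN.
have Y1 := Yup_vertex NT vv; have Yn := multiple_le nE n0 Y1.
have [r1 /andP[_ r2] r3] := mult_ratio RT vN.
have s0 : 0 <= (slack v)%:~R :> rat by rewrite ler0z slack_ge0.
have Ynr : (Yup v)%:~R <= (mult v)%:~R :> rat by rewrite ler_int.
have rest_ge0 x : (x \in calN T) && (x \notin gam (v0 T) v) -> 0 <= Delta x.
  by case/andP=> xN xv; apply: Delta_ge0 => //; apply: contraNneq xv => ->; apply: mem_gam_l.
have cNnotin y : y \in cN v -> y \notin gam (v0 T) v.
  by move/cN_ch; rewrite chE => /andP[].
have sub x : x \in gam (v0 T) v -> x != v -> {subset cN x <= gam (v0 T) v}.
  by rewrite gE mem_rcons inE => /orP[/eqP->|xl _]; [rewrite eqxx|rewrite -gE; apply: cNsub].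
have dic_below x : x \in gam (v0 T) v -> x != v -> dic_at x = set0.
  by rewrite gE mem_rcons inE => /orP[/eqP->|xl _]; [rewrite eqxx|apply: dic0].
have pos_below x : 0 < Delta v -> x \in gam (v0 T) v -> x != v0 T -> 0 < Delta x.
  by move=> Dv; rewrite gE mem_rcons inE => /orP[/eqP->//|]; apply: Dpos.
move: DE; set R := \sum_(x in calN T | _) _ => DE.
have R0 : 0 <= R by apply: sumr_ge0.
have restP : R = 0 -> forall y, y \in cN v -> Delta y = 0.
  by move=> Re y yc; apply: (psumr_eq0P rest_ge0 Re); rewrite (cN_calN yc) cNnotin.
have leaves : R = 0 -> forall y, y \in cN v -> cN y = set0.
  move=> Re y yc; have [] := Delta_eq0 RT nodes_eq (cN_calN yc) (cN_neq_v0 yc) (restP Re y yc).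
  by [].
have DvE := DeltaE_ch NT MC vN vn.
have [c0|c_neq0] := eqVneq (cN v) set0.
  have cE : calN T = [set x in gam (v0 T) v] :|: cN v.
    by apply: calN_top => // y; rewrite c0 in_set0.
  have RE : R = 0.
    by apply: big1 => x; rewrite cE c0 setU0 inE => /andP[->].
  have [|Dv dv tv] := leaf_end vN vn c0 nE; first by lra.
  exists v; split=> //; first by split=> // x; apply: pos_below.
    by move=> y; rewrite c0 in_set0.
  by apply: Or31.
have n2 : 2 <= (mult v)%:~R :> rat.
  by have /set0Pn[w /(mult_ge2 NT MC)] := c_neq0; rewrite (ler_int _ 2).
have node_slack : dic_at v != set0 -> (mult v)%:~R - 1 <= (slack v)%:~R :> rat.
  by move=> dv; have := slack_ge RT nodes_eq vN dv; rewrite -(ler_int rat) rmorphB.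
have c1 : (0 < #|cN v|)%N by rewrite card_gt0.
have c3 : (#|cN v| <= 2)%N.
  rewrite leqNgt; apply/negP; rewrite -(ler_nat rat 3) => c3.
  have : 0 <= (#|cN v|%:R - 3) * ((mult v)%:~R - 1) :> rat by apply: mulr_ge0; lra.
  by nra.
have [c2|c2] := leqP 2 #|cN v|.
  have ce : #|cN v| = 2%N by apply/eqP; rewrite eqn_leq c3 c2.
  rewrite ce in DvE; have Re : R = 0 by lra.
  have d0 : dic_at v = set0.
    apply/eqP; apply: contraT => /node_slack h.
    by suff : 0 < 0 :> rat by [rewrite ltxx]; lra.
  have Dv : 0 < Delta v by lra.
  exists v; split; [by []| |split=> // x; exact: pos_below|exact: restP|exact: Or33].
  by apply: calN_top => //; apply: leaves.
have ce : #|cN v| = 1%N by apply/eqP; rewrite eqn_leq -ltnS c2 c1.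
have /eqP/cards1P[w cw] := ce; have wc : w \in cN v by rewrite cw set11.
have Yw := Yup_vertex NT (calN_vertex (cN_calN wc)).
rewrite ce in DvE.
have [d0|dv] := eqVneq (dic_at v) set0; last first.
  have sn := node_slack dv; have Re : R = 0 by lra.
  have Dv : 0 < Delta v by lra.
  exists v; split; [by []| |split=> // x; exact: pos_below|exact: restP|].
    by apply: calN_top => //; apply: leaves.
  apply: Or32; split=> //; right.
  case: (node_dichotomy NT MC (node_in vN dv) nodes_eq) => [[[k tk] _]|h]; last first.
    have sn' : (mult v)%:~R <= (slack v)%:~R :> rat by rewrite ler_int.
    by suff : 0 < 0 :> rat by [rewrite ltxx]; lra.
  apply: type1_single => //; first by exists k.
  by rewrite ltzD1 (le_trans (ltW (sigma_lt_Yup vN wc))).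
have sl0 : slack v = 0 by apply: slack_no_dic.
have a2 : 2 <= a_ v by apply: single_dead.
have r4 := r3 a2; rewrite sl0 in DvE.
have nY : mult v = Yup v.
  case: (multiple_cases nE n0 Y1) => //; rewrite -(ler_int rat) rmorphMn mulr2n /= => h.
  by suff : 0 < 0 :> rat by [rewrite ltxx]; lra.
have q1 : qq v (par v) = 1.
  by apply: (mulIf (_ : Yup v != 0)); rewrite ?mul1r -?nE // gt_eqF // (lt_le_trans ltr01 Y1).
have Dv : 0 < Delta v by lra.
have wch := cN_ch wc; have pw := par_ch wch.
have YE : Yup v = a_ v * Yup w.
  case: (aP NT vv) a2 => // b b0 bv _.
  by rewrite (Yup_dead NT b0 bv) (sum_Yup_ch NT MC vN) cw d0 big_set1 big_set0 addr0 (a_dead NT b0 bv).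
have a0 : (a_ v)%:~R != 0 :> rat by rewrite intr_eq0 gt_eqF // (lt_le_trans _ a2).
have tE : (mult v)%:~R / (a_ v)%:~R = (Yup w)%:~R :> rat.
  by rewrite nY YE rmorphM /= mulrAC divff // mul1r.
have gwE := ch_gam wch.
apply: (IH w wch (cN_calN wc) (cN_neq_v0 wc)); rewrite ?pw.
- by move=> x xv; have [->//|xn] := eqVneq x v; apply: dic_below.
- by move=> x; apply: pos_below.
- move=> x xv y yx; rewrite gwE mem_rcons inE.
  have [xE|xn] := eqVneq x v; first by move: yx; rewrite xE cw => /set1P->; rewrite eqxx.
  by rewrite (sub x xv xn y yx) orbT.
- apply: mult_all_above => //; rewrite nY YE; congr (_ * _).
  have Qs : Qsib v w = a_ v.
    case: (aP NT vv) a2 => // b b0 bv _; rewrite (Qsib_dead NT b0 bv wch) ?(a_dead NT b0 bv) //.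
    apply: contraTneq (cN_calN wc) => ->; rewrite inE vertexN.
    by rewrite (arrows0_arrow b0).
  rewrite /Qn (bigD1 (par v)) /=; last first.
    rewrite adjE vn eqxx orbT; apply: contraTneq wch => <-; exact: par_nch.
  rewrite q1 mul1r -Qs; apply: eq_bigl => x.
  by rewrite -adj_par -!andbA; congr (_ && _); rewrite andbC.
have RwE : R = Delta w + \sum_(x in calN T | x \notin gam (v0 T) w) Delta x.
  rewrite /R (bigD1 w) /=; last by rewrite (cN_calN wc) cNnotin.
  congr (_ + _); apply: eq_bigl => x; rewrite gwE mem_rcons inE negb_or -andbA.
  by congr (_ && _); rewrite andbC.
rewrite tE nY in DvE; lra.
Qed.

End Comb.

Section CombStatement.

Variable T : decorated_tree.
Hypothesis RT : rational_tree T.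
Hypothesis nodes_eq : nodes T = nodes_star T.
Implicit Types x y v w u b : T.

Let NT : newton_tree T := rational_newton RT.
Let MC : minimally_complete T := rational_complete RT.

Hypothesis c1 : #|cN (v0 T)| = 1%N.
Hypothesis d0 : dic_at (v0 T) = set0.

Lemma root_ch : ch (v0 T) = cN (v0 T).
Proof.
apply/setP=> x; apply/idP/idP => [xv|]; last exact: cN_ch.
have := ch_cases NT MC (v0_calN NT) xv.
by rewrite d0 in_set0 (negPf (dead_v0 NT MC xv)) !orbF.
Qed.

Lemma Delta_root : Delta (v0 T) = 1 - (mult (v0 T))%:~R.
Proof. by rewrite (Delta_v0 RT) c1 slack_no_dic //; ring. Qed.

Lemma comb_exists : exists zn : T, comb zn.
Proof.
have vN := v0_calN NT.
have /eqP/cards1P[z cz] := c1; have zc : z \in cN (v0 T) by rewrite cz set11.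
have zN := cN_calN zc; have zn := cN_neq_v0 zc; have pz := cN_par zc.
have zch := cN_ch zc; have gz := ch_gam zch; rewrite gamxx /= in gz.
apply: (chain RT nodes_eq zN zn); rewrite ?pz ?gamxx.
- by move=> x; rewrite mem_seq1 => /eqP->.
- by move=> x; rewrite mem_seq1 => /eqP->; rewrite eqxx.
- by move=> x; rewrite mem_seq1 => /eqP-> y; rewrite cz gz => /set1P->; rewrite !inE eqxx orbT.
- apply: (mult_all_above RT zch); rewrite mult_v0 Yup_v0 // root_ch cz big_set1.
  rewrite [Qn _ _]big1 ?mul1r // => x /andP[vx _]; apply: qq_v0 => //.
  by rewrite ch_v0 inE.
have := Delta_sum RT; rewrite (bigD1 (v0 T)) //= (bigD1 z) /=; last by rewrite zN.
rewrite Delta_root mult_v0 Yup_v0 // root_ch cz big_set1.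
rewrite (eq_bigl (fun x => (x \in calN T) && (x \notin gam (v0 T) z))) => [|x].
  by move=> h; lra.
by rewrite gz !inE negb_or -andbA.
Qed.

Variable zn : T.
Hypothesis zn_comb : comb zn.

Let z := gam (v0 T) zn.

Lemma znN : zn \in calN T. Proof. by case: zn_comb => -[]. Qed.

Lemma zn_neq_v0 : zn != v0 T. Proof. by case: zn_comb => -[]. Qed.

Lemma calN_comb : calN T = [set x in z] :|: cN zn. Proof. by case: zn_comb. Qed.

Lemma Delta_chain x : x \in z -> x != v0 T -> 0 < Delta x.
Proof. by case: zn_comb => _ _ [h _] _ _; apply: h. Qed.

Lemma dic_chain x : x \in z -> x != zn -> dic_at x = set0.
Proof. by case: zn_comb => _ _ [_ h] _ _; apply: h. Qed.

Lemma Delta_tooth y : y \in cN zn -> Delta y = 0.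
Proof. by case: zn_comb => _ _ _ h _; apply: h. Qed.

Lemma tooth_notin y : y \in cN zn -> y \notin z.
Proof. by move/cN_ch; rewrite chE => /andP[]. Qed.

Lemma tooth_facts y : y \in cN zn ->
  [/\ cN y = set0, epsilon y = 1%N, type_one_mult y & y \in nodes T].
Proof.
move=> yc; have yN := cN_calN yc; have yn := cN_neq_v0 yc.
have [c0 _ t1 d2] := Delta_eq0 RT nodes_eq yN yn (Delta_tooth yc).
split=> //; [exact: epsilon_leaf|exact: type1_type_one_mult|].
by apply: node_in => //; rewrite -card_gt0; lia.
Qed.

Lemma tooth_adj y x : y \in cN zn -> x \in calN T -> adj y x = (x == zn).
Proof.
move=> yc xN; have [c0 _ _ _] := tooth_facts yc.
rewrite adjE (cN_neq_v0 yc) (cN_par yc) /=; case xy: (x \in ch y) => //=.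
have : x \in cN y by rewrite inE xy xN.
by rewrite c0 in_set0.
Qed.

Lemma calN_cases x : x \in calN T -> x \in z \/ x \in cN zn.
Proof. by rewrite calN_comb => /setUP[|]; [rewrite inE; left|right]. Qed.

Lemma gam_tooth y : y \in cN zn -> gam y zn = [:: y; zn].
Proof.
move=> yc; apply: (@gam_path T y [:: zn]) => /=; first by rewrite (tooth_adj yc znN) eqxx.
by rewrite inE andbT; apply: contraTneq (tooth_notin yc) => ->; rewrite negbK mem_gam_r.
Qed.

(** The paths of [Gamma] are the single edges from a tooth to [zn]: the other
    vertices of the chain have positive [Delta], hence are not interior to a
    trivial path, and no path starting at the root goes down. *)
Lemma in_GammaE y w : in_Gamma (gam y w) = (w == zn) && (y \in cN zn).
Proof.
apply/idP/andP => [|[/eqP-> yc]]; last first.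
  have [c0 ey _ _] := tooth_facts yc; have yN := cN_calN yc.
  have yzn : y != zn.
    by apply: contraTneq (tooth_notin yc) => ->; rewrite negbK mem_gam_r.
  rewrite gam_tooth // /in_Gamma /trivial_path /path_in_calN /= ey eqxx.
  rewrite -[edge_rel _ _ _]/(adj y zn) (tooth_adj yc znN) eqxx znN yN inE yzn /=.
  rewrite (Delta_tooth yc) lexx /=; apply/and3P; split.
  - by apply/forallP => -[[|[|i]] //].
  - rewrite /Delta_set (_ : [set x in [:: y; zn]] = y |: [set zn]); last first.
      by apply/setP=> x; rewrite !inE.
    rewrite big_setU1 ?inE // big_set1 (Delta_tooth yc).
    rewrite -[X in _ < X]/(0 + Delta zn) add0r.
    by apply: Delta_chain zn_neq_v0; apply: mem_gam_r.
  by have := cN_ch yc; rewrite inE => /andP[].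
have [p [e yp u l]] := gam_cons y w; rewrite e.
case/and4P=> /and4P[/andP[_ /allP pN] s _ /forallP mid] Dy _.
have lE : last (v0 T) (y :: p) = w := l; rewrite lE => desc.
have yN : y \in calN T by apply: pN; rewrite mem_head.
have [yz|yc] := calN_cases yN.
  have [y0|yn] := eqVneq y (v0 T); last by have := Delta_chain yz yn; rewrite ltNge Dy.
  (* From the root, the path only goes up. *)
  have e' : gam (v0 T) w = y :: p by rewrite -y0.
  by have := tltNge desc; rewrite e' mem_nth //= ltnS leq_pred.
case: p yp {e u desc Dy} l lE pN s mid => //= b p' /andP[yb _] l _ pN _ mid.
have bN : b \in calN T by apply: pN; rewrite !inE eqxx orbT.
have := tooth_adj yc bN; rewrite yb => /esym/eqP bE.
case: p' => [|b' p'] in l mid pN *; first by rewrite -l bE eqxx.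
have := mid (@Ordinal (size [:: y, b, b' & p']) 1 isT); rewrite /= bE => /andP[_ /eqP h].
by have := Delta_chain (mem_gam_r _ _) zn_neq_v0; rewrite h ltxx.
Qed.

Lemma VsetE w : Vset w = if w == zn then cN zn else set0.
Proof.
by apply/setP=> y; rewrite inE in_GammaE; case: eqP => //= _; rewrite inE.
Qed.

Lemma WsetE w : (w \in Wset T) = (w == zn) && (cN zn != set0).
Proof.
rewrite inE; apply/existsP/andP => [[y]|[wz /set0Pn[y yc]]].
  by rewrite in_GammaE => /andP[-> yc]; split=> //; apply/set0Pn; exists y.
by exists y; rewrite in_GammaE wz yc.
Qed.

Lemma bigcup_Vset : \bigcup_(w in Wset T) Vset w = cN zn.
Proof.
apply/setP=> y; apply/bigcupP/idP => [[w]|yc].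
  by rewrite WsetE VsetE => /andP[-> _].
exists zn; last by rewrite VsetE eqxx.
by rewrite WsetE eqxx; apply/set0Pn; exists y.
Qed.

Lemma Vbar_zn : cN zn != set0 -> Vbar zn :\ zn = cN zn.
Proof.
move=> cn; rewrite /Vbar WsetE eqxx cn VsetE eqxx /=.
apply/setP=> x; rewrite in_setD1; apply/andP/idP => [[xn /bigcupP[y yc]]|xc].
  by rewrite gam_tooth // in_set mem_seq2 (negPf xn) orbF => /eqP->.
split; first by apply: contraTneq (tooth_notin xc) => ->; rewrite negbK mem_gam_r.
by apply/bigcupP; exists x; rewrite // inE mem_gam_l.
Qed.

Lemma bigcup_Vbar : \bigcup_(w in Wset T) (Vbar w :\ w) = cN zn.
Proof.
apply/setP=> y; apply/bigcupP/idP => [[w]|yc].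
  by rewrite WsetE => /andP[/eqP-> cn]; rewrite Vbar_zn.
have cn : cN zn != set0 by apply/set0Pn; exists y.
by exists zn; rewrite ?Vbar_zn // WsetE eqxx.
Qed.

Lemma OmegaE : Omega T = [set v0 T].
Proof.
rewrite /Omega bigcup_Vset; apply/setP=> x; rewrite in_setD [x \in Zset T]inE in_set1.
apply/andP/eqP => [[xc /andP[xN /andP[_ Dx]]]|->].
  have [xz|] := calN_cases xN; last by rewrite (negPf xc).
  by apply/eqP; apply: contraTT Dx => xn; rewrite -ltNge Delta_chain.
split; first by apply/negP => /cN_neq_v0; rewrite eqxx.
rewrite v0_calN // (epsilon_v0 RT) c1 eqxx Delta_root /= subr_le0 ler1z.
by have := mult_v0_gt0 NT; lia.
Qed.

Lemma skeletonE : skeleton T = [set x in z].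
Proof.
rewrite /skeleton bigcup_Vbar calN_comb; apply/setP=> x; rewrite in_setD in_setU.
by case xc: (x \in cN zn); rewrite ?orbF //= inE (negPf (tooth_notin xc)).
Qed.

Lemma nodes_comb :
  nodes T = (if dic_at zn == set0 then set0 else [set zn]) :|: cN zn.
Proof.
apply/setP=> x; rewrite in_setU; apply/idP/orP => [|[]].
- rewrite inE => /andP[xN dx]; have [xz|] := calN_cases xN; last by right.
  have [xE|xn] := eqVneq x zn; last by rewrite (dic_chain xz xn) eqxx in dx.
  by left; rewrite -xE (negPf dx) inE.
- case: eqP => [_|/eqP dz]; first by rewrite in_set0.
  by move/set1P=> ->; apply: node_in dz; apply: znN.
by case/tooth_facts.
Qed.

Lemma comb_structure :
  #|Omega T| = 1%N /\
        exists z : seq T,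
          let z1 := head (v0 T) z in
          let zn := last (v0 T) z in
          [/\ path_in_calN z /\ (1 < size z)%N,
              Omega T = [set z1] /\ z1 = v0 T,
              valency (v0 T) = 1%N,
              skeleton T = [set x in z]
            & [\/ [/\ calN T = [set x in z],
                      nodes T = [set zn]
                    & node_type zn = [:: 1%N] \/
                      node_type zn = [:: 1%N; 1%N]],
                  exists y1 : T,
                    [/\ y1 \notin z, calN T = y1 |: [set x in z]
                      & forall x, x \in calN T -> adj y1 x = (x == zn)] /\
                    [/\ Vset zn = [set y1],
                        nodes T = [set y1] \/ nodes T = [set zn; y1],
                        type_one_mult y1
                      & zn \in nodes T -> node_type zn = [:: 1%N]]
                | exists y1 y2 : T,
                    [/\ [/\ y1 != y2, y1 \notin z & y2 \notin z],
                        calN T = [set y1; y2] :|: [set x in z],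
                        forall x, x \in calN T -> adj y1 x = (x == zn)
                      & forall x, x \in calN T -> adj y2 x = (x == zn)] /\
                    [/\ Vset zn = [set y1; y2],
                        nodes T = [set y1; y2],
                        type_one_mult y1
                      & type_one_mult y2]]].
Proof.
split; first by rewrite OmegaE cards1.
exists z; have [p [zE vp u l]] := gam_cons (v0 T) zn.
have -> : head (v0 T) z = v0 T by rewrite /z zE.
have -> : last (v0 T) z = zn by rewrite /z zE.
split.
- split; last first.
    rewrite /z zE; case: (p) l => //= l; by have := zn_neq_v0; rewrite -l eqxx.
  rewrite /path_in_calN; apply/andP; split; first by rewrite /z zE /= vp.
  by apply/allP => x xz; apply: (calN_gam RT znN).
- by rewrite OmegaE.
- by rewrite valencyE -ch_v0 root_ch.
- exact: skeletonE.
have [_ _ _ _] := zn_comb; case=> [[cn dz tz]|[cn dz]|[cn dz]].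
- apply: Or31; split=> //; first by rewrite calN_comb cn setU0.
  by rewrite nodes_comb cn setU0 (negPf dz).
- apply: Or32; have /eqP/cards1P[y1 cy] := cn; exists y1.
  have yc : y1 \in cN zn by rewrite cy set11.
  have [_ _ ty _] := tooth_facts yc.
  split; split=> //.
  + exact: tooth_notin.
  + by rewrite calN_comb cy setUC.
  + by move=> x; apply: tooth_adj.
  + by rewrite VsetE eqxx.
  + by rewrite nodes_comb cy; case: eqP => _; [left; rewrite set0U|right].
  case: dz => // dz; rewrite nodes_comb dz eqxx set0U => /(tooth_notin).
  by rewrite mem_gam_r.
apply: Or33; have /eqP/cards2P[y1 [y2 [y12 cy]]] := cn; exists y1, y2.
have yc1 : y1 \in cN zn by rewrite cy set21.
have yc2 : y2 \in cN zn by rewrite cy set22.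
have [_ _ ty1 _] := tooth_facts yc1; have [_ _ ty2 _] := tooth_facts yc2.
split; split=> //.
- by split=> //; apply: tooth_notin.
- by rewrite calN_comb cy setUC.
- by move=> x; apply: tooth_adj.
- by move=> x; apply: tooth_adj.
- by rewrite VsetE eqxx.
by rewrite nodes_comb cy dz eqxx set0U.
Qed.

End CombStatement.

Theorem proposition8p9 (T : decorated_tree)
    (T_rational : rational_tree T) (T_nodes : nodes T = nodes_star T) :
  [/\ Omega T = set0 -> elementary1 T \/ elementary2 T,
      #|Omega T| = 1%N ->
        exists z : seq T,
          let z1 := head (v0 T) z in
          let zn := last (v0 T) z in
          [/\ path_in_calN z /\ (1 < size z)%N,
              Omega T = [set z1] /\ z1 = v0 T,
              valency (v0 T) = 1%N,
              skeleton T = [set x in z]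
            & [\/ [/\ calN T = [set x in z],
                      nodes T = [set zn]
                    & node_type zn = [:: 1%N] \/
                      node_type zn = [:: 1%N; 1%N]],
                  exists y1 : T,
                    [/\ y1 \notin z, calN T = y1 |: [set x in z]
                      & forall x, x \in calN T -> adj y1 x = (x == zn)] /\
                    [/\ Vset zn = [set y1],
                        nodes T = [set y1] \/ nodes T = [set zn; y1],
                        type_one_mult y1
                      & zn \in nodes T -> node_type zn = [:: 1%N]]
                | exists y1 y2 : T,
                    [/\ [/\ y1 != y2, y1 \notin z & y2 \notin z],
                        calN T = [set y1; y2] :|: [set x in z],
                        forall x, x \in calN T -> adj y1 x = (x == zn)
                      & forall x, x \in calN T -> adj y2 x = (x == zn)] /\
                    [/\ Vset zn = [set y1; y2],
                        nodes T = [set y1; y2],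
                        type_one_mult y1
                      & type_one_mult y2]]]
    & #|Omega T| = 2%N ->
        exists z : seq T,
          let z1 := head (v0 T) z in
          let zn := last (v0 T) z in
          [/\ trivial_path z /\ calN T = [set x in z],
              size z = 2%N \/ size z = 3%N,
              size z = 3%N -> v0 T = nth (v0 T) z 1,
              forall x, x \in z -> a_ x = 1
            & nodes T = [set z1; zn] /\
              forall v, v \in nodes T ->
                type_one_mult v /\ (size (node_type v) = 1%N <-> v = v0 T)]].
Proof.
have NT := rational_newton T_rational; have MC := rational_complete T_rational.
have [c0|c_neq0] := eqVneq (cN (v0 T)) set0.
  rewrite (elementary_Omega T_rational c0) cards0; split=> // _.
  exact: elementary.
have [/andP[/eqP c1 /eqP d0]|h] :=
    boolP ((#|cN (v0 T)| == 1%N) && (dic_at (v0 T) == set0)).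
  have [zn zn_comb] := comb_exists T_rational T_nodes c1 d0.
  have [O1 S1] := comb_structure T_rational T_nodes c1 d0 zn_comb.
  rewrite O1; split=> // O0.
  by move: O1; rewrite O0 cards0.
have root_node : #|cN (v0 T)| = 1%N -> dic_at (v0 T) != set0.
  by move=> c1; move: h; rewrite c1 eqxx.
have [O2 S2] := nonnegative_structure T_rational T_nodes c_neq0 root_node.
rewrite O2; split=> // O0.
by move: O2; rewrite O0 cards0.
Qed.
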